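(* Let $k$ be a field, $n\in\mathbb{N}$, let $\mathbf{p}\subset\{1,\ldots,n\}$ and define $q_{1j}=\chi_{\mathbf{p}}(j)$ (equal to $1$ if $j\in\mathbf{p}$ and to $0$ otherwise) and $q_{2j}=0$ for $1\le j\le n$. Let $C_n$ be the commutative Hopf algebra with coproduct $\Delta$ determined by these parameters, and let $P(C_n^* )$ be the space of primitive elements of its graded dual $C_n^*$. Then: (i) The product $*$ given by $$D_s*D_t=\sum_{w=s\cup t}q(s,w)\,D_w ,$$ the sum ranging over all rooted trees $w$ in $C_n$ that have $s$ and $t$ as complementary colored subforests (one term for each tree $w$ and each subforest of $w$ isomorphic to $s$ whose complement is isomorphic to $t$), defines a pre-Lie algebra structure on $P(C_n^* )$. (ii) If $\mathbf{p}=\{1,\ldots,n\}$, then there is a natural inclusion of this pre-Lie algebra into the free pre-Lie algebra on $n$ generators. The image in the free pre-Lie algebra is spanned by all sums $\sum_{i\in\mathbf{p}}t_i$ of trees that only differ in that the color of the root of $t_i$ is $i$.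
   Context: A (right) pre-Lie algebra is a $k$-vector space $L$ with a bilinear product $*$ satisfying $(x*y)*z-x*(y*z)=(x*z)*y-x*(z*y)$ for all $x,y,z\in L$. The free pre-Lie algebra on $n$ generators is the vector space spanned by (isomorphism classes of) rooted trees with vertices labeled (colored) by elements of $\{1,\ldots,n\}$, with product $t*s=\sum_{v\in t}(\text{the tree obtained from } t \text{ and } s \text{ by adding an edge from the root of } s \text{ down to } v)$, labels preserved. A rooted tree is a finite partially ordered set with a minimal element (the root) such that $y\neq z$, $y<x$, $z<x$ imply $y<z$ or $z<y$; a forest is a finite disjoint union of rooted trees (possibly empty). Elements are vertices; $|t|$ is the number of vertices of $t$; an edge is a pair $v<w$ with nothing strictly between, and $v$ is its lower vertex. Trees and forests in $C_n$ have edges colored by $\{1,\ldots,n\}$ and are taken up to color-preserving isomorphism. $C_n=\mathsf{Com}[\lambda_n](0)$ is the initial unital commutative $k$-algebra equipped with a linear map $\lambda:C_n^{\otimes n}\to C_n$. Concretely, $C_n$ is the polynomial algebra on the set of rooted trees with edges colored by $\{1,\ldots,n\}$; it has as basis the forests, the product is disjoint union and the unit $1$ is the empty forest. For forests $x_1,\ldots,x_n$, $\lambda(x_1,\ldots,x_n)$ is the tree obtained from the forest $x_1\cdots x_n$ by adding a new root and connecting the root of each tree in $x_j$ to the new root by an edge of color $j$. For parameters $q_{ij}\in k$ ($i=1,2$, $1\le j\le n$) define linear maps $\sigma_1,\sigma_2:C_n^{\otimes n}\to C_n$ on forests by $\sigma_i(t_1,\ldots,t_n)=t_1\cdots t_n\cdot\prod_{j}q_{ij}^{|t_j|}$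 (with $0^0=1$). The coproduct $\Delta:C_n\to C_n\otimes C_n$ is the unique unital algebra homomorphism with $\Delta\circ\lambda=(\sigma_1\otimes\lambda+\lambda\otimes\sigma_2)\circ\tau\circ\Delta^{\otimes n}$, where $\tau:(C_n\otimes C_n)^{\otimes n}\to C_n^{\otimes n}\otimes C_n^{\otimes n}$ collects odd-position factors on the left and even-position factors on the right; the counit is $1$ on the empty forest and $0$ on nonempty forests. This makes $C_n$ a commutative Hopf algebra graded by number of vertices. The graded dual $C_n^*=\bigoplus_m((C_n)_m)^*$ is a cocommutative Hopf algebra with product dual to $\Delta$ and coproduct dual to the product of $C_n$; $\{D_u\}$ is the basis dual to the basis of forests $u$. Its primitive elements $P(C_n^* )$ have basis $\{D_t\}$, $t$ a (single) rooted tree. A subforest $s$ of a forest $t$ is a subset of the vertices of $t$ with the induced order; an edge $w<v$ of $s$ gets the color of that edge of $t$ with lower vertex $w$ lying on the unique path from $v$ down to $w$ in $t$. $s^c$ is the complementary subset, likewise a subforest. For $v\in s$, $p_j(v,s,t)$ is the number of edges of color $j$ on the path in $t$ from $v$ to the root of the connected component of $t$ containing $v$, that have their lower vertex in $s^c$. For a subforest $s$ of $t$, $$q(s,t)=\prod_j q_{1j}^{\sum_{v\in s}p_j(v,s,t)}\cdot\prod_j q_{2j}^{\sum_{v\in s^c}p_j(v,s^c,t)} ;$$ in the claim, $q(s,w)$ is evaluated at the given subforest of $w$ isomorphic to $s$.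
   Formalization: The product is taken in the opposite order (D_t*D_s = sum of q(s,w)D_w), since the printed order gives a left, not right, pre-Lie product; part (ii) assumes k has characteristic 0 and n ≥ 1, as it fails in positive characteristic and for n = 0. *)

(* Defs.v *)
From HB Require Import structures.
From mathcomp Require Import all_boot all_algebra perm finmap.
From mathcomp Require Import monalg.

Set Implicit Arguments.
Unset Strict Implicit.
Unset Printing Implicit Defensive.

Import GRing.Theory.
Local Open Scope ring_scope.
Local Open Scope quotient_scope.

Section Forests.

Context {L E : finType}.

(* Data of a forest on the vertex set V with vertex labels in L and edge
   colors in E.  The second component [c] encodes the strict order and the edge
   colors together: [c w v] is defined iff [w < v], and it is then the color
   of the edge with lower vertex [w] on the path from [v] down to [w].  (On a
   pair [w < v] that is an edge, this is the color of that edge.) *)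
Definition forest_data (V : finType) : Type :=
  ({ffun V -> L} * {ffun V -> {ffun V -> option E}})%type.

(* For [u < v < w], the edges with lower vertex [u] on the paths from [v] and
   from [w] down to [u] coincide: this is the second condition, which also
   contains transitivity.  The third one says that the vertices below a given
   vertex form a chain. *)
Definition wf_forest (V : finType) (F : forest_data V) : bool :=
  [&& [forall v, F.2 v v == None],
      [forall u, forall v, forall w, F.2 u v && F.2 v w ==> (F.2 u w == F.2 u v)]
    & [forall x, forall y, forall z,
        [&& y != z, isSome (F.2 y x) & isSome (F.2 z x)] ==>
          (F.2 y z || F.2 z y)]].

Record lforest (V : finType) : Type :=
  LForest { lforest_val :> forest_data V; lforestP : wf_forest lforest_val }.

HB.instance Definition _ (V : finType) := [isSub for @lforest_val V].
HB.instance Definition _ (V : finType) := [Finite of lforest V by <:].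

Definition vlab (V : finType) (F : lforest V) (v : V) : L := (lforest_val F).1 v.
Definition ecol (V : finType) (F : lforest V) (w v : V) : option E :=
  (lforest_val F).2 w v.

Section Order.
Context {V : finType}.
Implicit Types (F : lforest V) (v w : V).

Definition flt F w v : bool := ecol F w v.
Definition fle F w v : bool := (w == v) || flt F w v.
Definition edge F w v : bool := flt F w v && ~~ [exists x, flt F w x && flt F x v].
Definition minimal F v : bool := ~~ [exists w, flt F w v].
Definition is_ltree F : bool := [exists r, forall v, fle F r v].

Lemma ecol_irr F v : ecol F v v = None.
Proof.
by rewrite /ecol; case: F => F /= /and3P[/forallP/(_ v)/eqP].
Qed.

Lemma ecol_trans F u v w : flt F u v -> flt F v w -> ecol F u w = ecol F u v.
Proof.
rewrite /flt /ecol; case: F => F /= /and3P[_ /forallP/(_ u)/forallP/(_ v) h _].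
by move/forallP/(_ w)/implyP: h => h uv vw; apply/eqP/h; rewrite uv vw.
Qed.

Lemma flt_chain F x y z : y != z -> flt F y x -> flt F z x -> flt F y z || flt F z y.
Proof.
rewrite /flt /ecol; case: F => F /= /and3P[_ _ /forallP/(_ x)/forallP/(_ y) h].
by move/forallP/(_ z)/implyP: h => h yz yx zx; apply: h; rewrite yz yx zx.
Qed.

Lemma flt_irr F v : flt F v v = false. Proof. by rewrite /flt ecol_irr. Qed.

Lemma flt_trans F u v w : flt F u v -> flt F v w -> flt F u w.
Proof. by move=> uv vw; rewrite /flt (ecol_trans uv vw). Qed.

End Order.

Section Build.
Variables (V : finType) (l : V -> L) (c : V -> V -> option E).
Hypothesis c_irr : forall v, c v v = None.
Hypothesis c_trans : forall u v w, c u v -> c v w -> c u w = c u v.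
Hypothesis c_chain : forall x y z, y != z -> c y x -> c z x -> c y z || c z y.

Definition build_data : forest_data V :=
  (finfun l, [ffun w => finfun (c w)]).

Lemma build_wf : wf_forest build_data.
Proof.
apply/and3P; split.
- by apply/forallP => v; rewrite !ffunE c_irr.
- apply/forallP => u; apply/forallP => v; apply/forallP => w.
  by apply/implyP; rewrite !ffunE => /andP[uv vw]; rewrite (c_trans uv vw).
- apply/forallP => x; apply/forallP => y; apply/forallP => z.
  by apply/implyP; rewrite !ffunE => /and3P[]; apply: c_chain.
Qed.

Definition build : lforest V := LForest build_wf.

Lemma vlab_build v : vlab build v = l v.
Proof. by rewrite /vlab ffunE. Qed.

Lemma ecol_build w v : ecol build w v = c w v.
Proof. by rewrite /ecol !ffunE. Qed.

End Build.

Section Isomorphism.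
Context {V W : finType}.

Definition iso_map (F : lforest V) (G : lforest W) (f : V -> W) : Prop :=
  [/\ bijective f, forall v, vlab G (f v) = vlab F v
    & forall w v, ecol G (f w) (f v) = ecol F w v].

Definition iso (F : lforest V) (G : lforest W) : bool :=
  [exists f : {ffun V -> W},
    [&& injectiveb f, #|V| == #|W|, [forall v, vlab G (f v) == vlab F v]
      & [forall w, forall v, ecol G (f w) (f v) == ecol F w v]]].

Lemma isoP F G : reflect (exists f, iso_map F G f) (iso F G).
Proof.
apply: (iffP existsP) => [[f /and4P[/injectiveP fi /eqP VW /forallP fl fc]]|].
  exists f; split; first by apply: inj_card_bij; rewrite ?VW.
    by move=> v; apply/eqP.
  by move=> w v; apply/eqP; have /forallP/(_ w)/forallP := fc.
move=> [f [fb fl fc]]; exists (finfun f); apply/and4P; split.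
- by apply/injectiveP => x y; rewrite !ffunE; apply: bij_inj.
- by rewrite (bij_eq_card fb).
- by apply/forallP => v; rewrite ffunE fl.
- by apply/forallP => w; apply/forallP => v; rewrite !ffunE fc.
Qed.

End Isomorphism.

Lemma iso_sym (V W : finType) (F : lforest V) (G : lforest W) :
  iso F G -> iso G F.
Proof.
move=> /isoP[f [[g fK gK] fl fc]]; apply/isoP; exists g; split.
- by exists f.
- by move=> v; rewrite -fl gK.
- by move=> w v; rewrite -fc !gK.
Qed.

Lemma iso_trans (U V W : finType) (F : lforest U) (G : lforest V)
  (H : lforest W) : iso F G -> iso G H -> iso F H.
Proof.
move=> /isoP[f [fb fl fc]] /isoP[g [gb gl gc]]; apply/isoP; exists (g \o f).
by split=> [|v|w v] /=; [exact: bij_comp | rewrite gl | rewrite gc].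
Qed.

Definition sforest : Type := {m : nat & lforest 'I_m}.
HB.instance Definition _ := Choice.on sforest.

Definition siso (F G : sforest) : bool := iso (tagged F) (tagged G).

Lemma siso_refl : reflexive siso.
Proof.
by move=> F; apply/isoP; exists id; split=> //; exists id.
Qed.

Lemma siso_sym : symmetric siso.
Proof. by move=> F G; apply/idP/idP; apply: iso_sym. Qed.

Lemma siso_trans : transitive siso.
Proof. by move=> G F H; apply: iso_trans. Qed.

Canonical siso_equiv := EquivRel siso siso_refl siso_sym siso_trans.

Lemma siso_pi (F G : sforest) :
  (\pi_({eq_quot siso}) F == \pi_({eq_quot siso}) G) = siso F G.
Proof. by rewrite piE. Qed.

Section Pullback.
Variables (V W : finType) (F : lforest V) (f : W -> V).
Hypothesis f_inj : injective f.

Fact pullback_irr v : ecol F (f v) (f v) = None.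
Proof. exact: ecol_irr. Qed.

Fact pullback_trans u v w : ecol F (f u) (f v) -> ecol F (f v) (f w) ->
  ecol F (f u) (f w) = ecol F (f u) (f v).
Proof. exact: ecol_trans. Qed.

Fact pullback_chain x y z : y != z -> ecol F (f y) (f x) ->
  ecol F (f z) (f x) -> ecol F (f y) (f z) || ecol F (f z) (f y).
Proof. by rewrite -(inj_eq f_inj); apply: flt_chain. Qed.

Definition pullback : lforest W :=
  build (vlab F \o f) pullback_irr pullback_trans pullback_chain.

End Pullback.

End Forests.

Arguments lforest : clear implicits.
Arguments sforest : clear implicits.

Record forest_quotient (L E : finType) := ForestQuotient {
  fq_sort : choiceType;
  fq_pi : sforest L E -> fq_sort;
  fq_repr : fq_sort -> sforest L E;
  fq_reprK : cancel fq_repr fq_pi;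
  fq_piE : forall F G, (fq_pi F == fq_pi G) = siso F G
}.

(* The quotient is locked: comparing two classes by conversion would unfold the
   whole construction. *)
HB.lock Definition forest_quot (L E : finType) : forest_quotient L E :=
  @ForestQuotient L E {eq_quot (@siso L E)} \pi repr (@reprK _ _)
    (@siso_pi L E).

(* Isomorphism classes of forests, including the empty one. *)
Definition forest (L E : finType) : Type := fq_sort (forest_quot L E).
HB.instance Definition _ (L E : finType) := Choice.on (forest L E).

(* The isomorphism class of a forest. *)
HB.lock Definition cls (L E V : finType) (F : lforest L E V) : forest L E :=
  fq_pi (forest_quot L E)
    (Tagged (fun m => lforest L E 'I_m) (pullback F (@enum_val_inj V V))).

Section ForestClasses.

Context {L E : finType}.
Local Notation lforest := (lforest L E).
Local Notation forest := (forest L E).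

Definition frepr (u : forest) : sforest L E := fq_repr u.

(* Number of vertices, vertex set and structure of a chosen representative. *)
Definition fsize (u : forest) : nat := tag (frepr u).
Local Notation vert u := 'I_(fsize u).
Definition rep (u : forest) : lforest 'I_(fsize u) := tagged (frepr u).

Lemma cls_eq (V W : finType) (F : lforest V) (G : lforest W) :
  cls F = cls G <-> iso F G.
Proof.
have relab (U : finType) (H : lforest U) :
    iso (pullback H (@enum_val_inj U U)) H.
  apply/isoP; exists enum_val; split=> [|v|w v]; first exact: enum_val_bij.
    by rewrite vlab_build.
  by rewrite ecol_build.
split=> [/eqP|FG]; first rewrite cls.unlock fq_piE => FG.
  exact: iso_trans (iso_trans (iso_sym (relab _ F)) FG) (relab _ G).
apply/eqP; rewrite cls.unlock fq_piE.
exact: iso_trans (iso_trans (relab _ F) FG) (iso_sym (relab _ G)).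
Qed.

Lemma cls_rep u : cls (rep u) = u.
Proof.
rewrite -[RHS]fq_reprK cls.unlock; apply/eqP; rewrite fq_piE.
apply/isoP; exists enum_val; split=> [|v|w v]; first exact: enum_val_bij.
  by rewrite vlab_build.
by rewrite ecol_build.
Qed.

Lemma rep_cls (V : finType) (F : lforest V) : iso (rep (cls F)) F.
Proof. by apply/cls_eq; rewrite cls_rep. Qed.

(* The subforest on a set A of vertices, with the induced order; in this
   encoding the colors of its edges are given by restriction. *)
Definition subforest (V : finType) (F : lforest V) (A : {set V}) :
  lforest {v | v \in A} := pullback F val_inj.

Section DisjointUnion.
Variables (V W : finType) (F : lforest V) (G : lforest W).

Definition dunion_lab (x : V + W) : L :=
  match x with inl v => vlab F v | inr w => vlab G w end.
Definition dunion_col (x y : V + W) : option E :=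
  match x, y with
  | inl v, inl v' => ecol F v v'
  | inr w, inr w' => ecol G w w'
  | _, _ => None
  end.

Fact dunion_irr x : dunion_col x x = None.
Proof. by case: x => v; apply: ecol_irr. Qed.

Fact dunion_trans x y z : dunion_col x y -> dunion_col y z ->
  dunion_col x z = dunion_col x y.
Proof. by case: x y z => [x|x] [y|y] [z|z] //; apply: ecol_trans. Qed.

Fact dunion_chain x y z : y != z -> dunion_col y x -> dunion_col z x ->
  dunion_col y z || dunion_col z y.
Proof.
case: x y z => [x|x] [y|y] [z|z] //.
  by rewrite (inj_eq inl_inj); apply: flt_chain.
by rewrite (inj_eq inr_inj); apply: flt_chain.
Qed.

Definition dunion : lforest (V + W)%type :=
  build dunion_lab dunion_irr dunion_trans dunion_chain.

End DisjointUnion.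

Section Empty.
Fact empty_irr (v : void) : of_void (option E) v = None. Proof. by []. Qed.
Fact empty_trans (u v w : void) : of_void (option E) u -> of_void (option E) v ->
  of_void (option E) u = of_void (option E) u.
Proof. by []. Qed.
Fact empty_chain (x y z : void) : y != z -> of_void (option E) y ->
  of_void (option E) z -> of_void (option E) y || of_void (option E) z.
Proof. by []. Qed.

Definition lempty : lforest void :=
  build (of_void L) (c := fun v _ => of_void (option E) v)
    empty_irr empty_trans empty_chain.
End Empty.

Definition fone : forest := cls lempty.
Definition fmul (u v : forest) : forest := cls (dunion (rep u) (rep v)).

Lemma iso_dunion (V W V' W' : finType) (F : lforest V) (G : lforest W)
    (F' : lforest V') (G' : lforest W') :
  iso F F' -> iso G G' -> iso (dunion F G) (dunion F' G').
Proof.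
move=> /isoP[f [[f' fK f'K] fl fc]] /isoP[g [[g' gK g'K] gl gc]].
pose h (x : V + W) := match x with inl v => inl (f v) | inr w => inr (g w) end.
pose h' (x : V' + W') :=
  match x with inl v => inl (f' v) | inr w => inr (g' w) end.
apply/isoP; exists h; split; first by exists h' => [[]|[]] v /=; congruence.
  by case=> v; rewrite !vlab_build /=.
by case=> v [] w; rewrite !ecol_build /=.
Qed.

Lemma fmul_cls (V W : finType) (F : lforest V) (G : lforest W) :
  fmul (cls F) (cls G) = cls (dunion F G).
Proof. by apply/cls_eq/iso_dunion; apply: rep_cls. Qed.

Lemma fmulC : commutative fmul.
Proof.
move=> u v; rewrite -(cls_rep u) -(cls_rep v) !fmul_cls; apply/cls_eq/isoP.
pose h (A B : Type) (x : A + B) : B + A :=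
  match x with inl a => inr a | inr a => inl a end.
exists (@h _ _); split; first by exists (@h _ _) => -[].
  by case=> x; rewrite !vlab_build.
by case=> x [] y; rewrite !ecol_build.
Qed.

Lemma fmulA : associative fmul.
Proof.
move=> u v w; rewrite -(cls_rep u) -(cls_rep v) -(cls_rep w) !fmul_cls.
apply/cls_eq/isoP.
pose h (A B C : Type) (x : A + (B + C)) : A + B + C :=
  match x with
  | inl a => inl (inl a) | inr (inl b) => inl (inr b) | inr (inr c) => inr c
  end.
pose h' (A B C : Type) (x : A + B + C) : A + (B + C) :=
  match x with
  | inl (inl a) => inl a | inl (inr b) => inr (inl b) | inr c => inr (inr c)
  end.
exists (@h _ _ _); split; first by exists (@h' _ _ _) => -[|[]] // [].
  by case=> [x|[x|x]]; do 2!rewrite /= ?vlab_build.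
by case=> [x|[x|x]] [y|[y|y]]; do 2!rewrite /= ?ecol_build.
Qed.

Lemma fmul1m : left_id fone fmul.
Proof.
move=> u; rewrite -(cls_rep u) fmul_cls; apply/cls_eq/iso_sym/isoP.
exists inr; split; last by move=> v w; rewrite ecol_build.
  by exists (fun x : void + vert u =>
    match x with inl v => of_void _ v | inr w => w end) => // -[[]|].
by move=> v; rewrite vlab_build.
Qed.

Lemma fmulm1 : right_id fone fmul.
Proof. by move=> u; rewrite fmulC fmul1m. Qed.

Lemma fsize_cls (V : finType) (F : lforest V) : fsize (cls F) = #|V|.
Proof.
have /isoP[f [fb _ _]] := rep_cls F.
by rewrite -(bij_eq_card fb) card_ord.
Qed.

Lemma fsizeM u v : fsize (fmul u v) = (fsize u + fsize v)%N.
Proof. by rewrite fsize_cls card_sum !card_ord. Qed.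

Lemma fsize1 : fsize fone = 0%N.
Proof. by rewrite fsize_cls card_void. Qed.

Lemma fsize_eq0 u : fsize u = 0%N -> u = fone.
Proof.
move=> u0; rewrite -(cls_rep u); apply/cls_eq/isoP.
have no (v : vert u) : False by have := ltn_ord v; rewrite {2}u0.
exists (fun v => match no v with end); split; last by move=> v; case: (no v).
  by exists (of_void _) => [v|[]]; case: (no v).
by move=> v; case: (no v).
Qed.

Lemma fmul_eq1 u v : fmul u v = fone -> u = fone /\ v = fone.
Proof.
move=> /(congr1 fsize); rewrite fsizeM fsize1 => /eqP.
by rewrite addn_eq0 => /andP[/eqP/fsize_eq0-> /eqP/fsize_eq0->].
Qed.

HB.instance Definition _ :=
  Choice_isMonomialDef.Build forest fmulA fmul1m fmulm1 fmul_eq1.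
HB.instance Definition _ := MonomialDef_isConomialDef.Build forest fmulC.

(* The finitely many classes of forests with m vertices. *)
Definition forests (m : nat) : seq forest :=
  undup [seq fq_pi (forest_quot L E) (Tagged (fun i => lforest 'I_i) F)
        | F <- enum {: lforest 'I_m}].

Lemma mem_forests m u : (u \in forests m) = (fsize u == m).
Proof.
rewrite mem_undup; apply/mapP/eqP => [[F _ ->]|<-].
  have /eqP := fq_reprK (fq_pi (forest_quot L E) (Tagged (fun i => lforest 'I_i) F)).
  by rewrite fq_piE => /isoP[f [fb _ _]]; have := bij_eq_card fb; rewrite !card_ord.
exists (rep u); first by rewrite mem_enum.
by rewrite -[LHS]fq_reprK /rep /fsize /frepr; case: (fq_repr u).
Qed.

Definition is_tree (u : forest) : bool := is_ltree (rep u).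

Lemma is_ltree_iso (V W : finType) (F : lforest V) (G : lforest W) :
  iso F G -> is_ltree F -> is_ltree G.
Proof.
move=> /isoP[f [[g fK gK] _ fc]] /existsP[r /forallP rP].
apply/existsP; exists (f r); apply/forallP => v; have := rP (g v).
by rewrite /fle /flt -fc gK -(inj_eq (can_inj fK)) gK.
Qed.

Lemma is_tree_cls (V : finType) (F : lforest V) : is_tree (cls F) = is_ltree F.
Proof.
apply/idP/idP; first exact/is_ltree_iso/rep_cls.
exact/is_ltree_iso/iso_sym/rep_cls.
Qed.

(* Isomorphism classes of rooted trees. *)
Definition tree : Type := {u : forest | is_tree u}.
HB.instance Definition _ := Choice.on tree.

Definition cls_tree (V : finType) (F : lforest V) (treeF : is_ltree F) : tree :=
  exist _ (cls F) (etrans (is_tree_cls F) treeF).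

Definition automorphisms (u : forest) : {set {perm 'I_(fsize u)}} :=
  [set f : {perm 'I_(fsize u)} |
    [forall v, vlab (rep u) (f v) == vlab (rep u) v] &&
    [forall w, forall v, ecol (rep u) (f w) (f v) == ecol (rep u) w v]].

(* The forest obtained from F and G by adding, for each root r of G, an edge of
   color j with lower vertex v and upper vertex r. *)
Section Graft.
Variables (V W : finType) (F : lforest V) (v : V) (G : lforest W) (j : E).

Definition graft_col (x y : V + W) : option E :=
  match x, y with
  | inl a, inl b => ecol F a b
  | inl a, inr _ => if a == v then Some j else ecol F a v
  | inr _, inl _ => None
  | inr a, inr b => ecol G a b
  end.

Fact graft_irr x : graft_col x x = None.
Proof. by case: x => a; apply: ecol_irr. Qed.

Fact graft_trans x y z : graft_col x y -> graft_col y z ->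
  graft_col x z = graft_col x y.
Proof.
case: x y z => [x|x] [y|y] [z|z] //=; try exact: ecol_trans.
have [->|_] := eqVneq y v => [xv _|].
  by have [xE|//] := eqVneq x v; rewrite xE ecol_irr in xv.
have [->|_] := eqVneq x v; last exact: ecol_trans.
by move=> vy yv; have := flt_trans vy yv; rewrite flt_irr.
Qed.

Fact graft_chain x y z : y != z -> graft_col y x -> graft_col z x ->
  graft_col y z || graft_col z y.
Proof.
case: x y z => [x|x] [y|y] [z|z]; rewrite ?(inj_eq inl_inj) ?(inj_eq inr_inj) //=;
  try exact: flt_chain.
- have [->|yv] := eqVneq y v; have [->|zv] := eqVneq z v => //.
  + by move=> _ _ ->; rewrite orbT.
  + by move=> _ ->.
  + exact: flt_chain.
- by move=> _ ->.
Qed.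

Definition graft : lforest (V + W)%type :=
  build (dunion_lab F G) graft_irr graft_trans graft_chain.

Lemma graft_tree : is_ltree F -> is_ltree graft.
Proof.
move=> /existsP[r /forallP rP]; apply/existsP; exists (inl r).
apply/forallP => -[x|x]; rewrite /fle /flt ecol_build /=; first exact: rP.
by have := rP v; rewrite /fle; case: eqP.
Qed.

End Graft.

End ForestClasses.

Arguments tree : clear implicits.
Notation vert u := 'I_(fsize u).

Section ProdMonomial.
Variables M N : conomType.
Implicit Types x y z : (M * N)%type.

Definition pmul x y : M * N := (mmul x.1 y.1, mmul x.2 y.2).

Fact pmulA : associative pmul.
Proof. by move=> x y z; rewrite /pmul !mulmA. Qed.
Fact pmulC : commutative pmul.
Proof. by move=> x y; congr pair; apply: mulmC. Qed.
Fact pmul1m : left_id (mone, mone) pmul.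
Proof. by case=> x y; rewrite /pmul !mul1m. Qed.
Fact pmulm1 : right_id (mone, mone) pmul.
Proof. by move=> x; rewrite pmulC pmul1m. Qed.
Fact pmul_eq1 x y : pmul x y = (mone, mone) -> x = (mone, mone) /\ y = (mone, mone).
Proof. by case: x y => [x x'] [y y'] [/unitm[/= -> ->] /unitm[/= -> ->]]. Qed.

HB.instance Definition _ := Choice_isMonomialDef.Build (M * N)%type
  pmulA pmul1m pmulm1 pmul_eq1.
HB.instance Definition _ := MonomialDef_isConomialDef.Build (M * N)%type pmulC.
End ProdMonomial.

(* Forests with edges colored by {1, ..., n} and unlabeled vertices. *)
Notation eforest n := (forest unit 'I_n).
(* Rooted trees with vertices labeled by {1, ..., n} and uncolored edges. *)
Notation vtree n := (tree 'I_n unit).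

(* The underlying tree of [lambda (x_1, ..., x_n)]; [None] is the new root. *)
Section Lambda.
Context {n : nat}.
Variable x : 'I_n -> eforest n.

Let V := option {j : 'I_n & vert (x j)}.

Definition lam_col (a b : V) : option 'I_n :=
  match a, b with
  | None, Some v => Some (tag v)
  | Some u, Some v =>
      if tag u == tag v then ecol (rep (x (tag u))) (tagged u) (tagged_as u v)
      else None
  | _, None => None
  end.

Let node i (a : vert (x i)) : V := Some (Tagged (fun j => vert (x j)) a).

Fact lam_col_same i (a b : vert (x i)) :
  lam_col (node a) (node b) = ecol (rep (x i)) a b.
Proof. by rewrite /= eqxx tagged_asE. Qed.

Fact lam_colP (u v : {j : 'I_n & vert (x j)}) : lam_col (Some u) (Some v) ->
  exists i (a b : vert (x i)),
    [/\ u = Tagged _ a, v = Tagged _ b & flt (rep (x i)) a b].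
Proof.
case: u v => [i a] [j b] /=; case: eqP => // ij; case: j / ij b => b.
by rewrite tagged_asE => ab; exists i, a, b.
Qed.

Fact lam_irr a : lam_col a a = None.
Proof. by case: a => // -[i a]; rewrite lam_col_same ecol_irr. Qed.

Fact lam_trans a b c : lam_col a b -> lam_col b c -> lam_col a c = lam_col a b.
Proof.
case: b c => [b|] [c|] //; case: a => [a|] //.
  move=> /lam_colP[i [a' [b' [-> -> ab]]]] {a b}; move: ab.
  case: c => j c; have [ij|ij] := eqVneq i j; last by rewrite /= (negbTE ij).
  by case: j / ij c => c; rewrite !lam_col_same; exact: ecol_trans.
by move=> _ /lam_colP[i [b' [c' [-> -> _]]]].
Qed.

Fact lam_chain a b c : b != c -> lam_col b a -> lam_col c a ->
  lam_col b c || lam_col c b.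
Proof.
case: a b c => [a|] [b|] [c|] //.
move=> bc /lam_colP[i [b' [a' [bE -> ba]]]]; move: bc; rewrite {b}bE.
case: c => j c.
have [ij|ij] := eqVneq j i; last by rewrite /= (negbTE ij).
case: i / ij b' a' ba => b a' ba bc; rewrite !lam_col_same => ca.
by apply: flt_chain ba ca; apply: contra_neq bc => ->.
Qed.

Definition lam_forest : lforest unit 'I_n V :=
  build (fun=> tt) lam_irr lam_trans lam_chain.

Definition lam : eforest n := cls lam_forest.

End Lambda.

Section HopfAlgebra.

Variables (k : fieldType) (n : nat).

(* [C] is the algebra with basis the forests and product the disjoint union,
   and [C2] is its tensor square, with basis the pairs of forests. *)
Definition C : Type := {malg k[eforest n]}.
Definition C2 : Type := {malg k[(eforest n * eforest n)%type]}.
HB.instance Definition _ := GRing.ComAlgebra.on C.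
HB.instance Definition _ := GRing.ComAlgebra.on C2.

Definition tensor (x y : C) : C2 :=
  \sum_(u <- msupp x) \sum_(v <- msupp y) << x@_u * y@_v *g (u, v) >>.

Definition counit (x : C) : k := x@_(mone).

(* The n-linear extension of a map given on n-tuples of basis elements. *)
Definition mlin (X : choiceType) (W : lmodType k) (phi : ('I_n -> X) -> W)
    (a : 'I_n -> {malg k[X]}) : W :=
  \sum_(f : {ffun 'I_n -> (\big[@fsetU X/fset0]_(j < n) msupp (a j))})
    (\prod_j (a j)@_(val (f j))) *: phi (fun j => val (f j)).

(* The map [sigma_i], for [q = q_i], on a tuple of forests. *)
Definition sigma (q : 'I_n -> k) (t : 'I_n -> eforest n) : C :=
  (\prod_j q j ^+ fsize (t j)) *: \prod_j << t j >>.

(* The defining properties of the coproduct; the last one is the equation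
   [Delta \o lambda = (sigma_1 (x) lambda + lambda (x) sigma_2) \o tau \o
   Delta^(x)n], evaluated on forests. *)
Record is_coproduct (q1 q2 : 'I_n -> k) (Delta : C -> C2) : Prop := {
  coproduct_linear : forall (a : k) (x y : C),
    Delta (a *: x + y) = a *: Delta x + Delta y;
  coproduct_unit : Delta 1 = 1;
  coproduct_mul : forall x y : C, Delta (x * y) = Delta x * Delta y;
  coproduct_lambda : forall t : 'I_n -> eforest n,
    Delta << lam t >> =
    mlin (fun z : 'I_n -> eforest n * eforest n =>
            tensor (sigma q1 (fun j => (z j).1)) << lam (fun j => (z j).2) >> +
            tensor << lam (fun j => (z j).1) >> (sigma q2 (fun j => (z j).2)))
         (fun j => Delta << t j >>)
}.

(* The graded dual: a linear form on [C] that vanishes in all but finitely many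
   degrees is the same as a finitely supported function on forests.  The basis
   element [D_u] dual to the forest u is [<< u >>]. *)
Definition Cdual : Type := {malg k[eforest n]}.
HB.instance Definition _ := GRing.Lmodule.on Cdual.

Definition pairing (f : Cdual) (x : C) : k := \sum_(u <- msupp f) f@_u * x@_u.

(* The coproduct of [Cdual] is dual to the product of [C], and the unit of
   [Cdual] is the counit of [C]: this says that the coproduct of f is
   [f (x) 1 + 1 (x) f]. *)
Definition primitive (f : Cdual) : Prop :=
  forall x y : C,
    pairing f (x * y) = pairing f x * counit y + counit x * pairing f y.

(* For v in s, the number of edges of color j on the path from v to the root of
   its component, with lower vertex outside s. *)
Definition path_count (V : finType) (F : lforest unit 'I_n V) (j : 'I_n) (v : V)
    (s : {set V}) : nat :=
  #|[set e : V * V | [&& edge F e.1 e.2, fle F e.2 v,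
                         ecol F e.1 e.2 == Some j & e.1 \notin s]]|.

Definition qcoef (q1 q2 : 'I_n -> k) (V : finType) (F : lforest unit 'I_n V)
    (s : {set V}) : k :=
  (\prod_j q1 j ^+ (\sum_(v in s) path_count F j v s)) *
  (\prod_j q2 j ^+ (\sum_(v in ~: s) path_count F j v (~: s))).

(* The element [D_s * D_t].  The trees w that have s and t as complementary
   subforests have [fsize s + fsize t] vertices. *)
Definition dual_tree_mul (q1 q2 : 'I_n -> k) (s t : eforest n) : Cdual :=
  \sum_(w <- forests (fsize s + fsize t) | is_tree w)
    \sum_(A : {set vert w} | (cls (subforest (rep w) A) == s) &&
                             (cls (subforest (rep w) (~: A)) == t))
      qcoef q1 q2 (rep w) A *: (<< w >> : Cdual).

Definition dual_mul (q1 q2 : 'I_n -> k) (f g : Cdual) : Cdual :=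
  \sum_(s <- msupp f) \sum_(t <- msupp g)
    (f@_s * g@_t) *: dual_tree_mul q1 q2 s t.

(* The free pre-Lie algebra on n generators. *)
Definition freePL : Type := {malg k[vtree n]}.
HB.instance Definition _ := GRing.Lmodule.on freePL.

Definition graft_vtree (t : vtree n) (v : vert (val t)) (s : vtree n) : vtree n :=
  cls_tree (graft_tree v (rep (val s)) tt (valP t)).

Definition freePL_mul (x y : freePL) : freePL :=
  \sum_(t <- msupp x) \sum_(s <- msupp y)
    (x@_t * y@_s) *: \sum_(v : vert (val t)) (<< graft_vtree v s >> : freePL).

End HopfAlgebra.

(* The product m makes the subspace P of L a (right) pre-Lie algebra. *)
Record pre_Lie_on (k : fieldType) (L : lmodType k) (P : L -> Prop)
    (m : L -> L -> L) : Prop := {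
  pre_Lie_closed : forall x y, P x -> P y -> P (m x y);
  pre_Lie_linearl : forall (a : k) x y z, P x -> P y -> P z ->
    m (a *: x + y) z = a *: m x z + m y z;
  pre_Lie_linearr : forall (a : k) x y z, P x -> P y -> P z ->
    m z (a *: x + y) = a *: m z x + m z y;
  pre_Lie_identity : forall x y z, P x -> P y -> P z ->
    m (m x y) z - m x (m y z) = m (m x z) y - m x (m z y)
}.

Section Relabel.
Variables (L L' E E' : finType) (V : finType) (F : lforest L E V).
Variables (l : V -> L') (e : E -> E').

Let isSome_omap (o : option E) : isSome (omap e o) = isSome o.
Proof. by case: o. Qed.

Fact relabel_irr v : omap e (ecol F v v) = None.
Proof. by rewrite ecol_irr. Qed.

Fact relabel_trans u v w : omap e (ecol F u v) -> omap e (ecol F v w) ->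
  omap e (ecol F u w) = omap e (ecol F u v).
Proof. by rewrite !isSome_omap => uv vw; rewrite (ecol_trans uv vw). Qed.

Fact relabel_chain x y z : y != z -> omap e (ecol F y x) ->
  omap e (ecol F z x) -> omap e (ecol F y z) || omap e (ecol F z y).
Proof. rewrite !isSome_omap; exact: flt_chain. Qed.

(* F with its vertex labels replaced by l, and its edge colors changed by e. *)
Definition relabel : lforest L' E' V :=
  build l relabel_irr relabel_trans relabel_chain.

Lemma relabel_tree : is_ltree F -> is_ltree relabel.
Proof.
move=> /existsP[r /forallP rP]; apply/existsP; exists r; apply/forallP => v.
by have := rP v; rewrite /fle /flt ecol_build isSome_omap.
Qed.

End Relabel.

(* Replaces the label of the root by i. *)
Definition root_label n (i : 'I_n) (t : vtree n) : vtree n :=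
  cls_tree (relabel_tree
    (fun v => if minimal (rep (val t)) v then i else vlab (rep (val t)) v)
    id (valP t)).

(* Moves the color of every edge to its upper vertex, and labels the root by
   i. *)
Definition label_vertices n (i : 'I_n) (t : tree unit 'I_n) : vtree n :=
  cls_tree (relabel_tree
    (fun v => odflt i (obind (fun w => ecol (rep (val t)) w v)
                             [pick w | edge (rep (val t)) w v]))
    (fun=> tt) (valP t)).

(* Main.v *)
From HB Require Import structures.
Require Import Defs.
From mathcomp Require Import all_boot all_algebra perm finmap.
From mathcomp Require Import monalg.

Set Implicit Arguments.
Unset Strict Implicit.
Unset Printing Implicit Defensive.

Import GRing.Theory.
Local Open Scope ring_scope.

(** A primitive element of the dual is a linear form f that vanishes on every
    forest that is not a tree, because the other nonempty forests are the
    proper products ([primitiveP]).  So the product is understood through its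
    values.  With q2 = 0, the weight q(s, w) kills every complementary pair of
    subforests except those where s is the full branch B_x of w above a
    vertex x, and since q1 is 0 or 1 it is then 1 exactly when the path from x
    to the root has all its edges colored by p ([qcoefE]).  Calling such an x
    cuttable, the product is dual to cutting off one branch
    ([dual_mul_coef]):

      (f * g)(w) = sum over cuttable x of f(w - B_x) g(B_x).

    Part (i).  In ((f * g) * h)(w) two branches B_x and B_y are cut off, one
    after the other.  The terms where B_x lies inside B_y make up
    (f * (g * h))(w), since a vertex x above a cuttable y is cuttable in w iff
    it is cuttable in B_y.  What is left is a sum over pairs of disjoint
    branches ([cut_mul_associator]), which is symmetric in g and h.

    Part (ii).  A color on an edge can be read as a label on its upper vertex.
    This identifies edge-colored trees with vertex-labeled trees up to the
    label of the root, on which no edge puts a constraint; hence the sum over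
    all root labels.  A tree and its labeled versions have the same
    automorphisms, since these fix the root ([card_aut_color]).  The scaling
    by 1/|Aut t| turns cutting into grafting: for trees t, s and w, counting
    the isomorphisms from all graftings of s on t to w, and sorting them by
    the image x of the root of s, gives

      #{v | graft t v s = w} |Aut w|
        = #{x | w - B_x = t and B_x = s} |Aut t| |Aut s|

    ([card_embs_graft]).  In terms of the values multiplied by |Aut w|, the
    product of the free pre-Lie algebra is thus given by the same cutting
    formula ([freePL_mul_coef]), and the inclusion becomes the precomposition
    with the map that forgets the label of the root and moves the other labels
    to edges ([embs_sum_to_freePL]).  Precomposition commutes with cutting;
    it is injective because every edge-colored tree is reached, and its image
    consists of the functions that do not depend on the label of the root. *)

(** * Order and branches of a forest *)

Section ForestOrder.

Context {L E : finType} {V : finType}.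
Variable F : lforest L E V.
Implicit Types (u v w x y z : V) (A : {set V}).

Lemma fle_refl v : fle F v v. Proof. by rewrite /fle eqxx. Qed.

Lemma flt_fle v w : flt F v w -> fle F v w.
Proof. by rewrite /fle => ->; rewrite orbT. Qed.

Lemma fle_flt_trans u v w : fle F u v -> flt F v w -> flt F u w.
Proof. by case/orP => [/eqP->|]; last exact: flt_trans. Qed.

Lemma flt_fle_trans u v w : flt F u v -> fle F v w -> flt F u w.
Proof. by move=> uv /orP[/eqP<-|] //; apply: flt_trans. Qed.

Lemma fle_trans u v w : fle F u v -> fle F v w -> fle F u w.
Proof. by case/orP => [/eqP->//|uv vw]; apply/flt_fle/(flt_fle_trans uv). Qed.

Lemma fle_flt_false v w : fle F v w -> flt F w v -> False.
Proof. by move=> vw wv; have := fle_flt_trans vw wv; rewrite flt_irr. Qed.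

Lemma fle_chain x y z : fle F y x -> fle F z x -> fle F y z || flt F z y.
Proof.
move=> /orP[/eqP->|yx] /orP[/eqP->|zx].
- by rewrite fle_refl.
- by rewrite zx orbT.
- by rewrite flt_fle.
have [->|yz] := eqVneq y z; first by rewrite fle_refl.
by have /orP[/flt_fle->//|->] := flt_chain yz yx zx; rewrite orbT.
Qed.

Lemma fle_antisym y z : fle F y z -> fle F z y -> y = z.
Proof.
move=> yz /orP[/eqP//|zy]; by case: (fle_flt_false yz zy).
Qed.

Lemma ecol_fle u v w : flt F u v -> fle F v w -> ecol F u w = ecol F u v.
Proof. by move=> uv /orP[/eqP<-//|]; apply: ecol_trans. Qed.

(** Strictly monotone for the order of F: covers and parents are found by
    minimizing or maximizing it. *)
Definition height v := #|[set y | flt F y v]|.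

Lemma height_lt u v : flt F u v -> (height u < height v)%N.
Proof.
move=> uv; apply/proper_card/properP; split.
  by apply/subsetP => y; rewrite !inE => yu; apply: flt_trans uv.
by exists u; rewrite !inE ?flt_irr.
Qed.

Lemma edge_flt w v : edge F w v -> flt F w v. Proof. by case/andP. Qed.

Lemma edge_between w v x : edge F w v -> flt F w x -> flt F x v -> False.
Proof. by case/andP => _ /existsPn/(_ x); move=> /[swap]-> /[swap] ->. Qed.

Lemma flt_cover w v : flt F w v -> exists2 u, edge F w u & fle F u v.
Proof.
move=> wv.
have P0 : flt F w v && fle F v v by rewrite wv fle_refl.
have [u /andP[wu uv] umin] := @arg_minnP _ v (fun u => flt F w u && fle F u v) height P0.
exists u => //; rewrite /edge wu; apply/existsPn => x; apply/negP => /andP[wx xu].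
have := umin x; rewrite wx (fle_trans (flt_fle xu) uv) => /(_ isT).
by rewrite leqNgt height_lt.
Qed.

Lemma parent_exists v : ~~ minimal F v -> exists w, edge F w v.
Proof.
rewrite negbK => /existsP[w0 w0v].
have [w wv wmax] := @arg_maxnP _ w0 (fun w => flt F w v) height w0v.
exists w; rewrite /edge wv; apply/existsPn => x; apply/negP => /andP[wx xv].
by have := wmax x xv; rewrite /= leqNgt height_lt.
Qed.

Lemma minimal_below v : exists2 r, minimal F r & fle F r v.
Proof.
have [r rv rmin] := @arg_minnP _ v (fun r => fle F r v) height (fle_refl v).
exists r => //; apply/existsPn => x; apply/negP => xr.
by have := rmin x (fle_trans (flt_fle xr) rv); rewrite leqNgt height_lt.
Qed.

Lemma minimalP v w : minimal F v -> flt F w v = false.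
Proof. by move/existsPn/(_ w)/negbTE. Qed.

Lemma edge_lower_unique w w' v : edge F w v -> edge F w' v -> w = w'.
Proof.
move=> wv w'v; have wv' := edge_flt wv; have w'v' := edge_flt w'v.
have [//|ne] := eqVneq w w'; have /orP[h|h] := flt_chain ne wv' w'v'.
  by case: (edge_between wv h).
by case: (edge_between w'v h).
Qed.

Lemma edge_upper_unique w u u' v :
  edge F w u -> edge F w u' -> fle F u v -> fle F u' v -> u = u'.
Proof.
move=> wu wu' uv u'v; have /orP[/orP[/eqP//|h]|h] := fle_chain uv u'v.
  by case: (edge_between wu' (edge_flt wu) h).
by case: (edge_between wu (edge_flt wu') h).
Qed.

Lemma ltreeP : reflect (exists r, forall v, fle F r v) (is_ltree F).
Proof.
by apply: (iffP existsP) => -[r h]; exists r; [apply/forallP | apply/forallP].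
Qed.

Lemma root_minimal r : (forall v, fle F r v) -> minimal F r.
Proof.
by move=> h; apply/existsPn => w; apply/negP; apply/fle_flt_false.
Qed.

Lemma minimal_root r v : (forall v, fle F r v) -> minimal F v -> v = r.
Proof. by move=> h vmin; have /orP[/eqP//|] := h v; rewrite minimalP. Qed.

Definition branch x : {set V} := [set v | fle F x v].

(** [ecol F w x] is the color of the edge that leaves w on the path from w up
    to x, so the second condition says that all edges below x have their color
    in p. *)
Definition cuttable (p : {set E}) x : bool :=
  ~~ minimal F x && [forall w, oapp (mem p) true (ecol F w x)].

Lemma cuttableP (p : {set E}) x : reflect
  ((exists w, flt F w x) /\ (forall w c, ecol F w x = Some c -> c \in p))
  (cuttable p x).
Proof.
apply: (iffP andP); rewrite negbK => -[].
  move=> /existsP ? /forallP h; split=> // w c wx.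
  by have := h w; rewrite wx.
move=> ? h; split; first exact/existsP.
by apply/forallP => w; case wx: (ecol F w x) => [c|] //=; apply: h wx.
Qed.

Lemma cuttableT x : cuttable [set: E] x = ~~ minimal F x.
Proof.
rewrite /cuttable; case: (~~ _) => //=; apply/forallP => w.
by case: (ecol F w x) => //= c; rewrite inE.
Qed.

End ForestOrder.

Section SubforestClass.

Context {L E : finType}.

Lemma cls_id (V : finType) (F G : lforest L E V) :
  (forall v, vlab F v = vlab G v) -> (forall w v, ecol F w v = ecol G w v) ->
  cls F = cls G.
Proof.
move=> hl hc; apply/cls_eq/isoP; exists id; split=> //; by exists id.
Qed.

Lemma ecol_sub (V : finType) (F : lforest L E V) A w v :
  ecol (subforest F A) w v = ecol F (val w) (val v).
Proof. exact: ecol_build. Qed.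

Lemma vlab_sub (V : finType) (F : lforest L E V) A v :
  vlab (subforest F A) v = vlab F (val v).
Proof. exact: vlab_build. Qed.

Lemma flt_sub (V : finType) (F : lforest L E V) A w v :
  flt (subforest F A) w v = flt F (val w) (val v).
Proof. by rewrite /flt ecol_sub. Qed.

Lemma fle_sub (V : finType) (F : lforest L E V) A w v :
  fle (subforest F A) w v = fle F (val w) (val v).
Proof. by rewrite /fle flt_sub val_eqE. Qed.

(** The induced structure on a set depends on nothing but the image of an
    embedding onto that set: iterated and transported subforests are both
    instances of this. *)
Lemma cls_sub_embed (V W : finType) (F : lforest L E V) (G : lforest L E W)
    (A : {set V}) (f : W -> V) : injective f -> f @: setT = A ->
    (forall v, vlab F (f v) = vlab G v) ->
    (forall w v, ecol F (f w) (f v) = ecol G w v) ->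
  cls G = cls (subforest F A).
Proof.
move=> finj fA fl fc; apply/cls_eq/isoP.
have inA w : f w \in A by rewrite -fA imset_f.
exists (fun w => exist _ (f w) (inA w) : {v | v \in A}); split.
- apply: inj_card_bij => [w v /(congr1 val) /finj //|].
  by rewrite card_sig -[X in (_ <= X)%N](cardsT W) -(card_imset _ finj) fA.
- by move=> v; rewrite vlab_sub; apply: fl.
- by move=> w v; rewrite ecol_sub; apply: fc.
Qed.

Lemma cls_sub_sub (V : finType) (F : lforest L E V) (A : {set V})
    (B : {set {v | v \in A}}) :
  cls (subforest (subforest F A) B) = cls (subforest F (val @: B)).
Proof.
apply: (@cls_sub_embed _ _ _ _ _ (fun w => val (val w))).
- by move=> w v /val_inj/val_inj.
- apply/setP => v; apply/imsetP/imsetP => [[w _ ->]|[w wB ->]].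
    by exists (val w); first exact: valP.
  by exists (exist _ w wB).
- by move=> v; rewrite !vlab_sub.
- by move=> w v; rewrite !ecol_sub.
Qed.

Lemma cls_subT (V : finType) (F : lforest L E V) : cls (subforest F setT) = cls F.
Proof.
apply/esym/(@cls_sub_embed _ _ _ _ _ id) => //.
by apply/setP => v; rewrite (imset_id setT).
Qed.

End SubforestClass.

(** * Cutting off branches, and the pre-Lie identity *)

Section IsoInvariance.

Context {L E V W : finType}.
Variables (F : lforest L E V) (G : lforest L E W) (h : V -> W).
Hypothesis hiso : iso_map F G h.

Lemma iso_map_bij : bijective h. Proof. by case: hiso. Qed.

Lemma iso_map_inj : injective h. Proof. exact/bij_inj/iso_map_bij. Qed.

Lemma flt_iso w v : flt G (h w) (h v) = flt F w v.
Proof. by case: hiso => _ _ hc; rewrite /flt hc. Qed.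

Lemma fle_iso w v : fle G (h w) (h v) = fle F w v.
Proof. by rewrite /fle flt_iso (inj_eq iso_map_inj). Qed.

Lemma minimal_iso v : minimal G (h v) = minimal F v.
Proof.
have [g _ gK] := iso_map_bij; congr (~~ _).
apply/existsP/existsP => -[w wv]; last by exists (h w); rewrite flt_iso.
by exists (g w); rewrite -flt_iso gK.
Qed.

Lemma edge_iso w v : edge G (h w) (h v) = edge F w v.
Proof.
have [g _ gK] := iso_map_bij; rewrite /edge flt_iso; congr (_ && ~~ _).
apply/existsP/existsP => -[x]; last by exists (h x); rewrite !flt_iso.
by rewrite -(gK x) !flt_iso; exists (g x).
Qed.

Lemma cuttable_iso (p : {set E}) v : cuttable G p (h v) = cuttable F p v.
Proof.
have [g _ gK] := iso_map_bij; have [_ _ hc] := hiso.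
rewrite /cuttable minimal_iso; congr andb.
apply/forallP/forallP => hp w; first by rewrite -hc.
by rewrite -(gK w) hc.
Qed.

Lemma branch_iso v : branch G (h v) = h @: branch F v.
Proof.
have [g hK gK] := iso_map_bij; apply/setP => w.
by rewrite -(gK w) (mem_imset _ _ iso_map_inj) !inE fle_iso.
Qed.

Lemma cls_sub_iso A : cls (subforest F A) = cls (subforest G (h @: A)).
Proof.
have [_ hl hc] := hiso.
apply: (@cls_sub_embed _ _ _ _ _ _ _ (fun v => h (val v))).
- by move=> v w /iso_map_inj/val_inj.
- apply/setP => w; apply/imsetP/imsetP => [[v _ ->]|[v vA ->]].
    by exists (val v); first exact: valP.
  by exists (exist _ v vA).
- by move=> v; rewrite vlab_sub.
- by move=> v w; rewrite ecol_sub.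
Qed.

End IsoInvariance.

Lemma imset_setC (T U : finType) (h : T -> U) (A : {set T}) :
  bijective h -> h @: (~: A) = ~: (h @: A).
Proof.
move=> hbij; have [g _ gK] := hbij; apply/setP => w.
by rewrite -(gK w) inE !(mem_imset _ _ (bij_inj hbij)) inE.
Qed.

Section CutProduct.

Context {k : fieldType} {L E : finType}.
Variable p : {set E}.
Implicit Types f g h : forest L E -> k.

(** The product dual to cutting off a branch, for arbitrary functions on
    isomorphism classes of forests. *)
Definition cut_mul f g (V : finType) (F : lforest L E V) : k :=
  \sum_(x | cuttable F p x)
    f (cls (subforest F (~: branch F x))) * g (cls (subforest F (branch F x))).

Lemma cut_mul_iso f g (V W : finType) (F : lforest L E V) (G : lforest L E W) :
  iso F G -> cut_mul f g F = cut_mul f g G.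
Proof.
move=> /isoP[h hiso]; have hbij := iso_map_bij hiso.
rewrite /cut_mul [RHS](reindex h); last exact: onW_bij.
apply: eq_big => [x|x _]; first by rewrite (cuttable_iso hiso).
by rewrite (branch_iso hiso) -(imset_setC _ hbij) -!(cls_sub_iso hiso).
Qed.

(** Cutting inside a subforest, without leaving the ambient forest: what is
    asked of the vertices below x is then asked of those in A only. *)
Lemma cut_mul_sub f g (V : finType) (F : lforest L E V) (A : {set V}) :
  cut_mul f g (subforest F A) =
  \sum_(x in A | [exists (w | w \in A), flt F w x] &&
                 [forall (w | w \in A), oapp (mem p) true (ecol F w x)])
    f (cls (subforest F (A :\: branch F x))) *
    g (cls (subforest F (A :&: branch F x))).
Proof.
rewrite /cut_mul [RHS]big_sub_cond; apply: eq_big => [x|x _].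
  rewrite /cuttable negbK; congr andb.
    apply/existsP/existsP => [[w wx]|[w /andP[wA wx]]].
      by exists (val w); rewrite -flt_sub wx (valP w).
    by exists (exist _ w wA); rewrite flt_sub.
  apply/forallP/forallP => hp w; first apply/implyP => wA.
    by have := hp (exist _ w wA); rewrite ecol_sub.
  by rewrite ecol_sub; have /implyP := hp (val w); apply; apply: valP.
rewrite !cls_sub_sub; congr (f (cls (subforest F _)) * g (cls (subforest F _))).
  apply/setP => v; rewrite !inE; apply/imsetP/andP => [[w + ->]|[xv vA]].
    by rewrite !inE fle_sub (valP w).
  by exists (exist _ v vA) => //; rewrite !inE fle_sub.
apply/setP => v; rewrite !inE; apply/imsetP/andP => [[w + ->]|[vA xv]].
  by rewrite !inE fle_sub (valP w).
by exists (exist _ v vA) => //; rewrite !inE fle_sub.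
Qed.

Section Associator.

Variables (f g h : forest L E -> k) (V : finType) (F : lforest L E V).
Local Notation fc A := (cls (subforest F A)).
Local Notation B x := (branch F x).

Let disjoint_cut x y :=
  [&& cuttable F p x, cuttable F p y, ~~ fle F x y & ~~ fle F y x].

Lemma cut_mul_rep f' g' (u : forest L E) (V' : finType) (F' : lforest L E V') :
  cls F' = u -> cut_mul f' g' (rep u) = cut_mul f' g' F'.
Proof. by move=> <-; apply/cut_mul_iso/rep_cls. Qed.

(** Below a vertex that stays after B_x is removed, everything stays: the
    second cut has the same conditions as in F. *)
Lemma cut_mul_left_nested :
  cut_mul (fun u => cut_mul f g (rep u)) h F =
  \sum_(x | cuttable F p x) \sum_(y | cuttable F p y && ~~ fle F x y)
    f (fc (~: B x :\: B y)) * g (fc (~: B x :&: B y)) * h (fc (B x)).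
Proof.
apply: eq_bigr => x xp; rewrite (cut_mul_rep f g (erefl _)) cut_mul_sub.
rewrite mulr_suml; apply: eq_bigl => y; rewrite !inE andbC.
case xy: (fle F x y); rewrite ?andbF ?andbT //.
have below w : flt F w y -> w \in ~: B x.
  move=> wy; rewrite !inE; apply/negP => xw.
  by rewrite (fle_trans xw (flt_fle wy)) in xy.
rewrite /cuttable negbK; congr andb.
  by apply/existsP/existsP => -[w]; [case/andP; exists w | exists w; rewrite below].
apply/forallP/forallP => hp w; last by rewrite hp implybT.
have /implyP := hp w; case wy: (ecol F w y) => //=; apply.
by apply: below; rewrite /flt wy.
Qed.

(** The path from x to the root of F consists of the path inside B_y and of the
    path below y: so x is cuttable in B_y and y in F iff both are in F. *)
Lemma cut_mul_right_nested :
  cut_mul f (fun u => cut_mul g h (rep u)) F =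
  \sum_(y | cuttable F p y) \sum_(x | cuttable F p x && flt F y x)
    f (fc (~: B y)) * (g (fc (B y :\: B x)) * h (fc (B x))).
Proof.
apply: eq_bigr => y yp; rewrite (cut_mul_rep g h (erefl _)) cut_mul_sub.
rewrite mulr_sumr; apply: eq_big => [x|x /andP[+ _]]; last first.
  rewrite inE => yx; do 2!congr (_ * _); congr (h (fc _)).
  by apply/setIidPr/subsetP => v; rewrite !inE; apply: fle_trans.
rewrite inE; apply/and3P/andP => [[yx /existsP[w /andP[]]]|[xp yx]].
  rewrite inE => yw wx /forallP hp; have {w yw wx}yx := fle_flt_trans yw wx.
  split=> //; apply/cuttableP; split=> [|w c wxc]; first by exists y.
  have wx : flt F w x by rewrite /flt wxc.
  have /orP[yw|wy] := fle_chain (flt_fle yx) (flt_fle wx).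
    by have /implyP := hp w; rewrite inE wxc; apply.
  case/cuttableP: yp => _ /(_ w); apply.
  by rewrite -(ecol_fle wy (flt_fle yx)).
split; first exact: flt_fle.
  by apply/existsP; exists y; rewrite inE fle_refl.
apply/forallP => w; apply/implyP => _.
by case/andP: xp => _ /forallP.
Qed.

(** Two successive cuts are either nested, which accounts for the second term,
    or disjoint. *)
Lemma cut_mul_associator :
  cut_mul (fun u => cut_mul f g (rep u)) h F -
  cut_mul f (fun u => cut_mul g h (rep u)) F =
  \sum_x \sum_(y | disjoint_cut x y)
    f (fc (~: B x :&: ~: B y)) * g (fc (B y)) * h (fc (B x)).
Proof.
rewrite cut_mul_left_nested cut_mul_right_nested.
under eq_bigr => x _ do rewrite (bigID (fun y => flt F y x)) /=.
rewrite big_split /=; set S := (X in X + _ - _); set T := (X in _ - X).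
have -> : T = S.
  rewrite /S /T [RHS](exchange_big_dep (cuttable F p)) /=; last first.
    by move=> x y _ /andP[/andP[]].
  apply: eq_bigr => y yp; apply: eq_big => [x|x /andP[_ yx]].
    rewrite yp /=; case yx: (flt F y x); rewrite ?andbF ?andbT //.
    case xy: (fle F x y); last by rewrite andbT.
    by case: (fle_flt_false xy yx).
  rewrite mulrA; congr (f (fc _) * g (fc _) * _).
    apply/setP => v; rewrite !inE; case yv: (fle F y v) => //=.
    by apply/esym/negP => xv; rewrite (fle_trans (flt_fle yx) xv) in yv.
  by apply/setP => v; rewrite !inE.
rewrite addrAC subrr add0r [LHS]big_mkcond /=; apply: eq_bigr => x _.
rewrite /disjoint_cut; case: (cuttable F p x); last by rewrite big_pred0.
rewrite /=; apply: eq_big => [y|y].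
  rewrite -!andbA; congr andb; rewrite [fle F y x]/fle.
  by have [->|] := eqVneq y x; rewrite ?fle_refl.
move=> /andP[/andP[_ xy] yx].
rewrite setDE; congr (_ * g (fc _) * _).
apply/setP => v; rewrite !inE andbC; case yv: (fle F y v) => //=; apply/negP => xv.
have /orP[/orP[/eqP yxE|]|/flt_fle] := fle_chain yv xv.
- by rewrite yxE fle_refl in xy.
- by rewrite (negbTE yx).
- by rewrite (negbTE xy).
Qed.

End Associator.

Lemma cut_mul_pre_Lie f g h (V : finType) (F : lforest L E V) :
  cut_mul (fun u => cut_mul f g (rep u)) h F -
    cut_mul f (fun u => cut_mul g h (rep u)) F =
  cut_mul (fun u => cut_mul f h (rep u)) g F -
    cut_mul f (fun u => cut_mul h g (rep u)) F.
Proof.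
rewrite !cut_mul_associator (exchange_big_dep xpredT) //=; apply: eq_bigr => y _.
apply: eq_big => [x|x _]; last by rewrite setIC mulrAC.
by rewrite andbCA [~~ _ && ~~ _]andbC.
Qed.

End CutProduct.

(** * Primitive elements *)

Section Indecomposable.

Context {L E : finType}.

Lemma neq1_vertex (u : forest L E) : u != fone -> exists v : vert u, True.
Proof.
move=> u1; have u_gt0 : (0 < fsize u)%N.
  by rewrite lt0n; apply: contra_neq u1 => /fsize_eq0.
by exists (Ordinal u_gt0).
Qed.

Lemma fone_not_tree : ~~ is_tree (fone : forest L E).
Proof. by rewrite is_tree_cls; apply/ltreeP => -[[]]. Qed.

Lemma fmul_not_tree (u v : forest L E) :
  u != fone -> v != fone -> ~~ is_tree (fmul u v).
Proof.
move=> /neq1_vertex[a _] /neq1_vertex[b _]; rewrite is_tree_cls.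
by apply/ltreeP => -[[r /(_ (inr b))|r /(_ (inl a))]];
  rewrite /fle /flt ecol_build.
Qed.

(** A minimal vertex splits off the whole branch above it, since nothing
    below that branch is left to connect it to the rest. *)
Lemma not_tree_factor (u : forest L E) : u != fone -> ~~ is_tree u ->
  exists a b, [/\ a != fone, b != fone & u = fmul a b].
Proof.
move=> /neq1_vertex[v0 _] u_tree; set F := rep u.
have [r rmin _] := minimal_below F v0; pose A := branch F r.
have up w v : flt F w v -> (v \in A) = (w \in A).
  move=> wv; rewrite !inE; apply/idP/idP => [rv|rw]; last first.
    exact/(fle_trans rw)/flt_fle.
  by have := fle_chain rv (flt_fle wv); rewrite minimalP ?orbF.
have neq1 (B : {set vert u}) x : x \in B -> cls (subforest F B) != fone.
  move=> xB; apply/eqP => /(congr1 fsize)/eqP.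
  by rewrite fsize_cls fsize1 card_sig cards_eq0 => /eqP B0; rewrite B0 inE in xB.
exists (cls (subforest F A)), (cls (subforest F (~: A))); split.
- by apply: (neq1 _ r); rewrite inE fle_refl.
- have /existsP[x rx] : [exists x, ~~ fle F r x].
    apply: contraR u_tree => /existsPn h; apply/ltreeP; exists r => v.
    by rewrite -[fle _ _ _]negbK.
  by apply: (neq1 _ x); rewrite !inE.
- rewrite fmul_cls -[LHS]cls_rep; apply/esym/cls_eq/isoP.
  exists (fun x => match x with inl a => val a | inr b => val b end); split.
  + apply: inj_card_bij => [|].
      case=> [[a aA]|[a aA]] [[b bA]|[b bA]] /= ab.
      * by congr inl; apply: val_inj.
      * by exfalso; move: bA; rewrite -ab inE aA.
      * by exfalso; move: aA; rewrite ab inE bA.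
      * by congr inr; apply: val_inj.
    by rewrite card_sum !card_sig -(cardsC A).
  + by case=> a; rewrite vlab_build /= vlab_sub.
  + have no w v : (v \in A) != (w \in A) -> ecol F w v = None.
      by case wv: (ecol F w v) => //; rewrite (up w v) ?eqxx // /flt wv.
    case=> [[a aA]|[a aA]] [[b bA]|[b bA]]; rewrite ecol_build /= ?ecol_sub //; apply: no.
      by move: bA; rewrite inE => /negbTE->; rewrite aA.
    by move: aA; rewrite inE => /negbTE->; rewrite bA.
Qed.

End Indecomposable.

Section FiniteSupport.

Context {k : fieldType} {K : choiceType}.
Implicit Types f : {malg k[K]}.

(** A coefficient as a sum over the support, the form in which coefficients
    enter the bilinear extensions below. *)
Lemma msupp_sum_pick f (x : K) : \sum_(u <- msupp f) f@_u * (u == x)%:R = f@_x.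
Proof.
rewrite [RHS](congr1 (mcoeff x) (monalgE f)) raddf_sum /=.
by apply: eq_bigr => u _; rewrite mcoeffU mulr_natr.
Qed.

End FiniteSupport.

Section Primitive.

Variables (k : fieldType) (n : nat).
Implicit Types f : Cdual k n.

Lemma pairing_sum f (I : Type) (r : seq I) (x : I -> C k n) :
  pairing f (\sum_(i <- r) x i) = \sum_(i <- r) pairing f (x i).
Proof.
rewrite /pairing exchange_big; apply: eq_bigr => u _.
by rewrite (raddf_sum (mcoeff u)) mulr_sumr.
Qed.

Lemma pairingU f c u : pairing f (<< c *g u >> : C k n) = f@_u * c.
Proof.
rewrite /pairing -(msupp_sum_pick f u) mulr_suml; apply: eq_bigr => v _.
by rewrite mcoeffU [u == v]eq_sym -mulrA mulr_natl.
Qed.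

(** On basis elements, primitivity says f(uv) = f(u) [v = 1] + [u = 1] f(v): it
    forces f(1) = 0 and f(uv) = 0 for u, v <> 1, and every nonempty forest that
    is not a tree is such a product. *)
Lemma primitiveP f : primitive f <-> (forall u, ~~ is_tree u -> f@_u = 0).
Proof.
split=> [fP u uT|fT x y].
  have pU v : pairing f (<< v >> : C k n) = f@_v by rewrite pairingU mulr1.
  have cU v : counit (<< v >> : C k n) = (v == fone)%:R by rewrite /counit mcoeffU1.
  have fM v w : f@_(fmul v w) = f@_v * (w == fone)%:R + (v == fone)%:R * f@_w.
    by rewrite -!pU -!cU -fP malgM_def fgmulUU mulr1.
  have [->|u1] := eqVneq u fone.
    have := fM fone fone; rewrite fmul1m eqxx mulr1 mul1r.
    by move/eqP; rewrite -subr_eq0 opprD addrA subrr add0r oppr_eq0 => /eqP.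
  have [a [b [a1 b1 ->]]] := not_tree_factor u1 uT.
  by rewrite fM (negbTE a1) (negbTE b1) mulr0 mul0r addr0.
have fM v w : f@_(mmul v w) = f@_v * (w == mone)%:R + (v == mone)%:R * f@_w.
  have f1 : f@_mone = 0 by apply/fT/fone_not_tree.
  have [->|v1] := eqVneq v mone; have [->|w1] := eqVneq w mone.
  - by rewrite mul1m f1 mul0r mulr0 addr0.
  - by rewrite mul1m mulr0 add0r mul1r.
  - by rewrite mulm1 mulr1 mul0r addr0.
  - by rewrite mulr0 mul0r addr0; apply/fT/fmul_not_tree.
have pE z : pairing f z = \sum_(u <- msupp z) f@_u * z@_u.
  by rewrite [in LHS](monalgE z) pairing_sum; apply: eq_bigr => u _; rewrite pairingU.
have cE z : counit z = \sum_(u <- msupp z) z@_u * (u == mone)%:R.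
  by rewrite msupp_sum_pick.
rewrite malgME pairing_sum !pE !cE !mulr_suml -big_split; apply: eq_bigr => u _ /=.
rewrite pairing_sum !mulr_sumr -big_split; apply: eq_bigr => v _ /=.
rewrite pairingU fM mulrDl; congr (_ + _).
  by rewrite -!mulrA; congr (_ * _); rewrite mulrC mulrA.
by rewrite -!mulrA [RHS]mulrCA; congr (_ * _); rewrite mulrCA [f@_v * _]mulrC.
Qed.

End Primitive.

(** * The dual product cuts off branches *)

Section DualProduct.

Variables (k : fieldType) (n : nat) (p : {set 'I_n}) (q1 q2 : 'I_n -> k).
Hypothesis q1E : forall j, q1 j = (if j \in p then 1 else 0).
Hypothesis q2E : forall j, q2 j = 0.

Section Weight.

Variables (V : finType) (F : lforest unit 'I_n V) (A : {set V}).

Lemma path_count_eq0 j v (s : {set V}) : reflect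
  (forall w u, edge F w u -> fle F u v -> ecol F w u = Some j -> w \in s)
  (path_count F j v s == 0%N).
Proof.
rewrite cards_eq0; apply: (iffP eqP) => [/setP h w u wu uv c|h].
  by have := h (w, u); rewrite !inE /= wu uv c eqxx /= => /negbFE.
apply/setP => -[w u]; rewrite !inE /=; apply/negP => /and4P[wu uv /eqP c].
by rewrite (h w u).
Qed.

Lemma prod_expr01 (q : 'I_n -> k) (P : {set 'I_n}) (e : 'I_n -> nat) :
  (forall j, q j = (if j \in P then 1 else 0)) ->
  \prod_j q j ^+ e j = [forall (j | j \notin P), e j == 0%N]%:R.
Proof.
move=> qE; case: forallP => [h|/forallP/forallPn[j]].
  apply: big1 => j _; rewrite qE; case: ifPn => jP; first by rewrite expr1n.
  by have /implyP/(_ jP)/eqP-> := h j.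
rewrite negb_imply => /andP[jP ej].
by rewrite (bigD1 j) //= qE (negbTE jP) expr0n (negbTE ej) mul0r.
Qed.

(** The second factor, a power of 0, is nonzero iff the complement of A is
    closed downwards, that is, iff A is the branch above its root r.  Then the
    edges counted by the first factor are those on the path below r. *)
Lemma qcoefE : is_ltree F -> is_ltree (subforest F A) -> is_ltree (subforest F (~: A)) ->
  qcoef q1 q2 F A = \sum_(x | cuttable F p x) (A == branch F x)%:R.
Proof.
move=> /ltreeP[r0 r0P] /ltreeP[[r rA] rP] /ltreeP[[r' r'A] _].
have rmin v : v \in A -> fle F r v.
  by move=> vA; have := rP (exist _ v vA); rewrite fle_sub.
rewrite /qcoef (prod_expr01 _ q1E) (@prod_expr01 q2 set0) => [|j]; last first.
  by rewrite q2E inE.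
rewrite -natrM mulnb.
have -> : [forall (j | j \notin set0), \sum_(v in ~: A) path_count F j v (~: A) == 0%N]
        = (A == branch F r).
  apply/forallP/eqP => [h|Ar j].
    apply/setP => v; rewrite inE; apply/idP/idP => [|rv]; first exact: rmin.
    (* An outside v above r would see the edge that leaves r towards v. *)
    apply/negbNE/negP => vA; have rv' : flt F r v.
      by move: rv => /orP[/eqP rv|//]; rewrite -rv rA in vA.
    have [u ru uv] := flt_cover rv'; have := edge_flt ru; rewrite /flt.
    case c: (ecol F r u) => [j|] // _.
    have := h j; rewrite inE /= sum_nat_eq0 => /forallP/(_ v).
    rewrite inE vA /= => /path_count_eq0/(_ _ _ ru uv c).
    by rewrite inE rA.
  apply/implyP => _; rewrite sum_nat_eq0; apply/forallP => v; apply/implyP.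
  rewrite inE Ar inE => rv; apply/path_count_eq0 => w u wu uv _; rewrite !inE.
  apply: contra rv => rw; apply: fle_trans (fle_trans rw _) uv.
  exact/flt_fle/edge_flt.
have [Ar|Ar] := eqVneq A (branch F r); last first.
  rewrite andbF big1 // => x xp; case: eqP => // Ax; case/eqP: Ar.
  rewrite Ax; congr branch; apply: (@fle_antisym _ _ _ F).
    by have : r \in A := rA; rewrite Ax inE.
  by apply: rmin; rewrite Ax inE fle_refl.
have r'r : ~~ fle F r r'.
  by have : r' \in ~: A := r'A; rewrite Ar !inE.
have branch_inj x : (A == branch F x) = (x == r).
  rewrite Ar; apply/eqP/eqP => [/setP h|->//].
  apply: (@fle_antisym _ _ _ F); first by have := h r; rewrite !inE fle_refl => /esym.
  by have := h x; rewrite !inE fle_refl.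
under [RHS]eq_bigr => x _ do rewrite branch_inj.
rewrite big_mkcond (bigD1 r) //= eqxx big1 ?addr0 => [|x /negbTE->]; last first.
  by case: ifP.
have -> : (if cuttable F p r then true%:R else 0) = (cuttable F p r)%:R :> k by case: ifP.
rewrite andbT; congr ((nat_of_bool _)%:R).
apply/forallP/cuttableP => [h|[_ h] j].
  split.
    exists r0; have /orP[/eqP r0r|//] := r0P r.
    by rewrite -r0r r0P in r'r.
  move=> w c wr; apply/negbNE/negP => cp.
  have wr' : flt F w r by rewrite /flt wr.
  have [u wu ur] := flt_cover wr'.
  have := h c; rewrite cp sum_nat_eq0 => /forallP/(_ r); rewrite rA /=.
  move=> /path_count_eq0/(_ w u wu ur).
  rewrite (ecol_fle (edge_flt wu) ur) in wr.
  by rewrite wr Ar inE => /(_ erefl) rw; case: (fle_flt_false rw wr').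
apply/implyP => jp; rewrite sum_nat_eq0.
apply/forallP => v; apply/implyP; rewrite Ar inE => rv.
apply/path_count_eq0 => w u wu uv wuj; rewrite inE.
have wv := flt_fle_trans (edge_flt wu) uv.
have /orP[//|wr] := fle_chain rv (flt_fle wv).
rewrite (h w) // in jp; rewrite -(ecol_fle wr rv) -wuj.
exact: ecol_fle (edge_flt wu) uv.
Qed.

End Weight.

(** What is below x survives the cut, so a root of the remainder is also below
    the branch that was removed. *)
Lemma cut_tree (V : finType) (F : lforest unit 'I_n V) x :
  ~~ minimal F x -> is_ltree (subforest F (~: branch F x)) -> is_ltree F.
Proof.
rewrite negbK => /existsP[w wx] /ltreeP[[r rB] rP]; apply/ltreeP; exists r => v.
have rmin u : ~~ fle F x u -> fle F r u.
  move=> xu; have uB : u \in ~: branch F x by rewrite !inE.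
  by have := rP (exist _ u uB); rewrite fle_sub.
case xv: (fle F x v); last by rewrite rmin ?xv.
apply: fle_trans (fle_trans (flt_fle wx) xv); apply: rmin.
by apply/negP => xw; apply: fle_flt_false xw wx.
Qed.

(** By cardinality, the forests with complementary subforests isomorphic to s
    and t are all among those over which the product sums. *)
Lemma dual_tree_mul_coef (s t w : eforest n) : is_tree s -> is_tree t ->
  (dual_tree_mul q1 q2 s t)@_w = (is_tree w)%:R *
    \sum_(x | cuttable (rep w) p x)
       (s == cls (subforest (rep w) (branch (rep w) x)))%:R *
       (t == cls (subforest (rep w) (~: branch (rep w) x)))%:R.
Proof.
move=> sT tT; set F := rep w.
have -> : (dual_tree_mul q1 q2 s t)@_w = (is_tree w)%:R *
    \sum_(A | (cls (subforest F A) == s) && (cls (subforest F (~: A)) == t))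
      qcoef q1 q2 F A.
  rewrite /dual_tree_mul (raddf_sum (mcoeff w)) /=.
  under eq_bigr => v _.
    rewrite (raddf_sum (mcoeff w)) /=.
    under eq_bigr do rewrite mcoeffZ mcoeffU1.
    rewrite -mulr_suml; over.
  have [wm|wm] := boolP (w \in forests (fsize s + fsize t)).
    rewrite big_mkcond (bigD1_seq w) ?undup_uniq //= eqxx mulr1 [X in _ + X]big1 ?addr0.
      by case: (is_tree w); rewrite ?mul1r ?mul0r.
    by move=> v /negbTE vw; rewrite vw mulr0; case: ifP.
  rewrite big1_seq => [|v /andP[_ vm]]; last first.
    by case: eqP => [vw|_]; rewrite ?mulr0 // -vw vm in wm *.
  rewrite [X in _ * X]big1 ?mulr0 // => A /andP[/eqP sA /eqP tA].
  case/negP: wm; rewrite mem_forests -sA -tA !fsize_cls !card_sig.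
  by rewrite (cardsC A) card_ord.
have [wT|_] := boolP (is_tree w); last by rewrite !mul0r.
congr (_ * _); under eq_bigr => A /andP[/eqP sA /eqP tA].
  rewrite qcoefE //; try by rewrite -is_tree_cls ?sA ?tA.
  over.
rewrite exchange_big; apply: eq_bigr => x _ /=.
rewrite big_mkcond (bigD1 (branch F x)) //= eqxx big1 ?addr0.
  by rewrite -natrM mulnb ![_ == s]eq_sym ![_ == t]eq_sym; case: ifP.
by move=> A /negbTE->; case: ifP.
Qed.

(** The formula also holds when F is not a tree, where both sides vanish: a cut
    whose remainder is a tree was made in a tree. *)
Lemma dual_mul_coef (f g : Cdual k n) (V : finType) (F : lforest unit 'I_n V) :
  primitive f -> primitive g ->
  (dual_mul q1 q2 g f)@_(cls F) = cut_mul p (fun u => f@_u) (fun u => g@_u) F.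
Proof.
move=> /primitiveP fT /primitiveP gT; set w := cls F.
have <- : cut_mul p (fun u => f@_u) (fun u => g@_u) (rep w) =
          cut_mul p (fun u => f@_u) (fun u => g@_u) F by apply/cut_mul_iso/rep_cls.
have supp_tree (h : Cdual k n) : (forall u, ~~ is_tree u -> h@_u = 0) ->
    forall u, u \in msupp h -> is_tree u.
  by move=> hT u; rewrite -mcoeff_neq0; apply: contraR => /hT->.
rewrite /dual_mul (raddf_sum (mcoeff w)) /=.
pose B x := cls (subforest (rep w) (branch (rep w) x)).
pose B' x := cls (subforest (rep w) (~: branch (rep w) x)).
transitivity (\sum_(s <- msupp g) \sum_(t <- msupp f)
    \sum_(x | cuttable (rep w) p x)
      (is_tree w)%:R * ((f@_t * (t == B' x)%:R) * (g@_s * (s == B x)%:R))).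
  apply: eq_big_seq => s sg; rewrite (raddf_sum (mcoeff w)) /=.
  apply: eq_big_seq => t tf; rewrite mcoeffZ.
  rewrite (dual_tree_mul_coef _ (supp_tree g gT s sg) (supp_tree f fT t tf)).
  rewrite mulrCA !mulr_sumr; apply: eq_bigr => x _; congr (_ * _).
  by rewrite mulrACA mulrC.
under eq_bigr => s _ do rewrite exchange_big.
rewrite exchange_big; apply: eq_bigr => x /andP[xr _] /=.
have -> : f@_(B' x) * g@_(B x) = (is_tree w)%:R * (f@_(B' x) * g@_(B x)).
  have [_|wT] := boolP (is_tree w); first by rewrite mul1r.
  rewrite fT ?mul0r ?mulr0 // is_tree_cls; apply: contra wT; exact: cut_tree.
rewrite -(msupp_sum_pick f) -(msupp_sum_pick g) mulr_suml mulr_sumr exchange_big.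
apply: eq_bigr => t _ /=; rewrite !mulr_sumr; apply: eq_bigr => s _ //.
Qed.

Lemma dual_mul_primitive (f g : Cdual k n) :
  primitive f -> primitive g -> primitive (dual_mul q1 q2 g f).
Proof.
move=> fP gP; apply/primitiveP => u uT; rewrite -[u]cls_rep dual_mul_coef //.
apply: big1 => x /andP[xr _]; move/primitiveP: fP => -> //; first by rewrite mul0r.
by rewrite is_tree_cls; apply: contra uT; apply: cut_tree.
Qed.

Lemma primitive_linear a (f g : Cdual k n) :
  primitive f -> primitive g -> primitive (a *: f + g).
Proof.
move=> /primitiveP fT /primitiveP gT; apply/primitiveP => u uT.
by rewrite mcoeffD mcoeffZ fT ?gT // mulr0 addr0.
Qed.

Lemma dual_mul_pre_Lie :
  pre_Lie_on (@primitive k n) (fun f g : Cdual k n => dual_mul q1 q2 g f).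
Proof.
have coef u f g := @dual_mul_coef f g _ (rep u).
split=> [|a x y z Px Py Pz|a x y z Px Py Pz|x y z Px Py Pz].
- exact: dual_mul_primitive.
- apply/malgP => u; rewrite mcoeffD mcoeffZ -(cls_rep u) !coef //; last exact: primitive_linear.
  rewrite /cut_mul mulr_sumr -big_split /=; apply: eq_bigr => v _.
  by rewrite mcoeffD mcoeffZ mulrDl mulrA.
- apply/malgP => u; rewrite mcoeffD mcoeffZ -(cls_rep u) !coef //; last exact: primitive_linear.
  rewrite /cut_mul mulr_sumr -big_split /=; apply: eq_bigr => v _.
  by rewrite mcoeffD mcoeffZ mulrDr mulrCA.
have mulE f g : primitive f -> primitive g ->
    (fun u => (dual_mul q1 q2 g f)@_u) =1
    (fun u => cut_mul p (fun v => f@_v) (fun v => g@_v) (rep u)).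
  by move=> Pf Pg u; rewrite -coef // cls_rep.
have assocE f g h u : primitive f -> primitive g -> primitive h ->
    (dual_mul q1 q2 h (dual_mul q1 q2 g f)
      - dual_mul q1 q2 (dual_mul q1 q2 h g) f)@_u =
    cut_mul p (fun u => cut_mul p (fun v => f@_v) (fun v => g@_v) (rep u))
      (fun v => h@_v) (rep u) -
    cut_mul p (fun v => f@_v)
      (fun u => cut_mul p (fun v => g@_v) (fun v => h@_v) (rep u)) (rep u).
  move=> Pf Pg Ph; have Pfg := dual_mul_primitive Pf Pg.
  have Pgh := dual_mul_primitive Pg Ph.
  rewrite mcoeffB (mulE _ _ Pfg Ph u) (mulE _ _ Pf Pgh u).
  congr (_ - _); apply: eq_bigr => v _; congr (_ * _); exact: mulE.
apply/malgP => u; rewrite [LHS]assocE // [RHS]assocE //; exact: cut_mul_pre_Lie.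
Qed.

End DualProduct.

(** * Isomorphisms and graftings *)

Section Embeddings.

Context {L E : finType}.

(** The isomorphisms from F to the subforest of G on A, seen as maps to the
    vertices of G: this avoids working with functions into a subtype. *)
Definition embs (V W : finType) (F : lforest L E V) (G : lforest L E W)
    (A : {set W}) : {set {ffun V -> W}} :=
  [set f : {ffun V -> W} |
    [&& injectiveb f, f @: setT == A, [forall v, vlab G (f v) == vlab F v]
      & [forall w, forall v, ecol G (f w) (f v) == ecol F w v]]].

Lemma embsP (V W : finType) (F : lforest L E V) (G : lforest L E W) A (f : {ffun V -> W}) :
  reflect [/\ injective f, f @: setT = A, forall v, vlab G (f v) = vlab F v
            & forall w v, ecol G (f w) (f v) = ecol F w v]
          (f \in embs F G A).
Proof.
rewrite inE; apply: (iffP and4P).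
  move=> [/injectiveP fi /eqP fA /forallP fl /forallP fc]; split=> //.
    by move=> v; apply/eqP.
  by move=> w v; apply/eqP; have /forallP := fc w.
move=> [fi fA fl fc]; split; [exact/injectiveP | exact/eqP | |].
  by apply/forallP => v; rewrite fl.
by apply/forallP => w; apply/forallP => v; rewrite fc.
Qed.

(** The isomorphisms to a given object form a torsor under the automorphisms of
    the source, as soon as there is one. *)
Lemma card_embs (V W : finType) (F : lforest L E V) (G : lforest L E W) A :
  #|embs F G A| =
  if cls F == cls (subforest G A) then #|embs F F setT| else 0%N.
Proof.
case: eqP => [/cls_eq/isoP[h hiso]|FA]; last first.
  apply: eq_card0 => f; apply/negP => /embsP[fi fA fl fc].
  exact/FA/(cls_sub_embed fi fA).
have [hbij hl hc] := hiso.
pose e v := val (h v); have einj : injective e.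
  by move=> v w /val_inj/(bij_inj hbij).
have eA v : e v \in A by apply: valP.
pose post (f : {ffun V -> V}) : {ffun V -> W} := [ffun v => e (f v)].
have post_inj : injective post.
  move=> f g /ffunP fg; apply/ffunP => v; apply: einj.
  by have := fg v; rewrite !ffunE.
have el v : vlab G (e v) = vlab F v by rewrite -hl vlab_sub.
have ec w v : ecol G (e w) (e v) = ecol F w v by rewrite -hc ecol_sub.
rewrite -(card_imset _ post_inj); apply: eq_card => f.
apply/embsP/imsetP => [[fi fA fl fc]|[g /embsP[gi gT gl gc] ->]].
  have ecodom v : f v \in codom e.
    have fvA : f v \in A by rewrite -fA imset_f.
    have [h' _ h'K] := hbij; apply/codomP; exists (h' (exist _ (f v) fvA)).
    by rewrite /e h'K.
  pose g := [ffun v => iinv (ecodom v)].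
  have eg v : e (g v) = f v by rewrite ffunE f_iinv.
  exists g; last by apply/ffunP => v; rewrite ffunE eg.
  have gi : injective g by move=> v w /(congr1 e); rewrite !eg; apply: fi.
  apply/embsP; split=> //.
  - by apply/eqP; rewrite eqEcard subsetT cardsT card_imset // cardsT leqnn.
  - by move=> v; rewrite -el eg.
  - by move=> w v; rewrite -ec !eg.
split.
- by move=> v w; rewrite !ffunE => /einj/gi.
- apply/setP => w; apply/imsetP/idP => [[v _ ->]|wA]; first by rewrite ffunE.
  have [h' _ h'K] := hbij.
  have /imsetP[v _ vE] : h' (exist _ w wA) \in g @: setT by rewrite gT inE.
  by exists v; rewrite // ffunE -vE /e h'K.
- by move=> v; rewrite ffunE el gl.
- by move=> w v; rewrite !ffunE ec gc.
Qed.

Lemma card_embs_iso (V W : finType) (F : lforest L E V) (G : lforest L E W) :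
  iso F G -> #|embs F F setT| = #|embs G G setT|.
Proof.
suff le (V' W' : finType) (F' : lforest L E V') (G' : lforest L E W') :
    iso F' G' -> (#|embs F' F' setT| <= #|embs G' G' setT|)%N.
  by move=> FG; apply/eqP; rewrite eqn_leq !le // iso_sym.
move=> /isoP[h [[g hK gK] hl hc]].
pose conj (f : {ffun V' -> V'}) : {ffun W' -> W'} := [ffun w => h (f (g w))].
have conj_inj : injective conj.
  move=> f1 f2 /ffunP f12; apply/ffunP => v; apply: (can_inj hK).
  by have := f12 (h v); rewrite !ffunE hK.
rewrite -(card_imset _ conj_inj); apply/subset_leq_card/subsetP => f'.
move=> /imsetP[f /embsP[fi fT fl fc] ->]; apply/embsP.
have ci : injective (conj f).
  by move=> v w; rewrite !ffunE => /(can_inj hK)/fi/(can_inj gK).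
split=> // [|v|w v].
- by apply/eqP; rewrite eqEcard subsetT cardsT card_imset // cardsT leqnn.
- by rewrite ffunE hl fl -hl gK.
- by rewrite !ffunE hc fc -hc !gK.
Qed.

Lemma card_automorphisms (u : forest L E) :
  #|automorphisms u| = #|embs (rep u) (rep u) setT|.
Proof.
pose fun_of (f : {perm vert u}) : {ffun vert u -> vert u} := [ffun v => f v].
have fun_inj : injective fun_of.
  move=> f g /ffunP fg; apply/permP => v; by have := fg v; rewrite !ffunE.
rewrite -(card_imset _ fun_inj); apply: eq_card => f.
apply/imsetP/embsP => [[g + ->]|[fi fT fl fc]].
  rewrite inE => /andP[/forallP gl /forallP gc].
  have gi : injective (fun_of g) by move=> v w; rewrite !ffunE => /perm_inj.
  split=> // [|v|w v].
  - by apply/eqP; rewrite eqEcard subsetT cardsT card_imset // cardsT leqnn.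
  - by rewrite ffunE; apply/eqP.
  - by rewrite !ffunE; apply/eqP; have /forallP := gc w.
exists (perm fi); last by apply/ffunP => v; rewrite ffunE permE.
rewrite inE; apply/andP; split.
  by apply/forallP => v; rewrite permE fl.
by apply/forallP => w; apply/forallP => v; rewrite !permE fc.
Qed.

Lemma card_automorphisms_gt0 (u : forest L E) : (0 < #|automorphisms u|)%N.
Proof.
rewrite card_automorphisms card_gt0; apply/set0Pn; exists [ffun v => v].
apply/embsP; split=> [v w|| v|w v]; rewrite ?ffunE //.
apply/setP => v; rewrite inE; apply/imsetP; exists v; rewrite ?ffunE //.
Qed.

End Embeddings.

Section GraftCount.

Context {L E : finType} {Vt Vs V : finType}.
Variables (T : lforest L E Vt) (S : lforest L E Vs) (G : lforest L E V).
Variable s0 : Vs.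
Hypothesis s0_root : forall b, fle S s0 b.

Definition glue (ab : {ffun Vt -> V} * {ffun Vs -> V}) : {ffun Vt + Vs -> V} :=
  [ffun x => match x with inl a => ab.1 a | inr b => ab.2 b end].

Lemma glue_bij : bijective glue.
Proof.
exists (fun f : {ffun Vt + Vs -> V} =>
          ([ffun a => f (inl a)], [ffun b => f (inr b)])).
  by case=> a b; congr pair; apply/ffunP => v; rewrite !ffunE.
by move=> f; apply/ffunP => -[v|v]; rewrite !ffunE.
Qed.

Variables (alpha : {ffun Vt -> V}) (beta : {ffun Vs -> V}).
Let z := beta s0.

Definition cut_embs x :=
  (alpha \in embs T G (~: branch G x)) && (beta \in embs S G (branch G x)).

(** The vertex at which G is cut can be recovered from the embedding of S: it
    is the image of the root. *)
Lemma cut_embs_root x : cut_embs x -> x = z.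
Proof.
case/andP => _ /embsP[bi bB bl bc].
have /imsetP[b _ xE] : x \in beta @: setT by rewrite bB inE fle_refl.
have : z \in branch G x by rewrite -bB imset_f.
rewrite inE => xz; apply: (@fle_antisym _ _ _ G) => //.
have := s0_root b; rewrite /z xE /fle /flt bc => /orP[/eqP->|->].
  by rewrite eqxx.
by rewrite orbT.
Qed.

(** An isomorphism from a grafting to G is the same thing as a pair of
    isomorphisms to the two parts of a cut of G at z, provided that the grafting
    vertex v and the color j are those of the edge below z. *)
Lemma glue_graft v j :
  (glue (alpha, beta) \in embs (graft T v S j) G setT) =
  [&& ecol G (alpha v) z == Some j, edge G (alpha v) z & cut_embs z].
Proof.
set f := glue _; have fl a : f (inl a) = alpha a by rewrite ffunE.
have fr b : f (inr b) = beta b by rewrite ffunE.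
apply/embsP/and3P => [[fi fT flab fcol]|[/eqP cz ez]].
  have colll a a' : ecol G (alpha a) (alpha a') = ecol T a a'.
    by rewrite -!fl fcol ecol_build.
  have colrr b b' : ecol G (beta b) (beta b') = ecol S b b'.
    by rewrite -!fr fcol ecol_build.
  have collr a b : ecol G (alpha a) (beta b) =
      if a == v then Some j else ecol T a v.
    by rewrite -fl -fr fcol ecol_build.
  have colrl a b : ecol G (beta b) (alpha a) = None.
    by rewrite -fl -fr fcol ecol_build.
  have zr b : fle G z (beta b).
    have /orP[/eqP<-|sb] := s0_root b; first exact: fle_refl.
    by apply: flt_fle; rewrite /flt colrr.
  have zl a : fle G z (alpha a) = false.
    by rewrite /fle /flt colrl orbF /z -fl -fr (inj_eq fi).
  have cover y : (exists a, y = alpha a) \/ (exists b, y = beta b).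
    have /imsetP[[a|b] _ ->] : y \in f @: setT by rewrite fT inE.
      by left; exists a.
    by right; exists b.
  have zv : flt G (alpha v) z by rewrite /flt collr eqxx.
  split.
  - by rewrite collr eqxx.
  - rewrite /edge zv; apply/existsPn => y; apply/negP => /andP[vy yz].
    have [[a ya]|[b yb]] := cover y; last first.
      by rewrite yb in yz; case: (fle_flt_false (zr b) yz).
    move: vy yz; rewrite ya /flt colll collr => va; case: eqP => [av|_ av].
      by move: va; rewrite av ecol_irr.
    by have := flt_trans va av; rewrite flt_irr.
  - apply/andP; split; apply/embsP; split=> //.
    + by move=> a a'; rewrite -!fl => /fi[].
    + apply/setP => y; rewrite !inE; apply/imsetP/idP => [[a _ ->]|zy].
        by rewrite zl.
      have [[a ->]|[b yb]] := cover y; first by exists a.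
      by rewrite yb zr in zy.
    + by move=> a; rewrite -fl flab vlab_build.
    + by move=> b b'; rewrite -!fr => /fi[].
    + apply/setP => y; rewrite !inE; apply/imsetP/idP => [[b _ ->]|zy].
        exact: zr.
      have [[a ya]|[b ->]] := cover y; last by exists b.
      by rewrite ya zl in zy.
    + by move=> b; rewrite -fr flab vlab_build.
case/andP => /embsP[ai aA al ac] /embsP[bi bB bl bc].
have za a : fle G z (alpha a) = false.
  have : alpha a \in ~: branch G z by rewrite -aA imset_f.
  by rewrite !inE => /negbTE.
have zb b : fle G z (beta b).
  have : beta b \in branch G z by rewrite -bB imset_f.
  by rewrite inE.
have ezv := edge_flt ez.
split.
- move=> [a|b] [a'|b']; rewrite ?fl ?fr.
  + by move=> /ai->.
  + by move=> ab; have := za a; rewrite ab zb.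
  + by move=> ab; have := za a'; rewrite -ab zb.
  + by move=> /bi->.
- apply/setP => y; rewrite inE; have [zy|zy] := boolP (y \in branch G z).
    move: zy; rewrite -bB => /imsetP[b _ ->]; apply/imsetP.
    by exists (inr b); rewrite ?fr.
  move: zy; rewrite -in_setC -aA => /imsetP[a _ ->]; apply/imsetP.
  by exists (inl a); rewrite ?fl.
- by case=> [a|b]; rewrite vlab_build ?fl ?fr /= ?al ?bl.
- case=> [a|b] [a'|b']; rewrite ecol_build ?fl ?fr /= ?ac ?bc //.
  + have [->|av] := eqVneq a v; first by rewrite (ecol_fle ezv (zb _)).
    rewrite -ac; have [avlt|avn] := boolP (flt G (alpha a) (alpha v)).
      by rewrite (ecol_trans avlt (flt_fle_trans ezv (zb _))).
    rewrite [RHS](_ : _ = None); last by move: avn; rewrite /flt; case: (ecol _ _ _).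
    case abE: (ecol G (alpha a) (beta b')) => [c|] //.
    have ab : flt G (alpha a) (beta b') by rewrite /flt abE.
    have /orP[|az] := fle_chain (zb b') (flt_fle ab); first by rewrite za.
    have ne : alpha a != alpha v by rewrite (inj_eq ai).
    have := flt_chain ne az ezv; rewrite (negbTE avn) /= => va.
    by case: (edge_between ez va az).
  + case abE: (ecol G (beta b) (alpha a')) => [c|] //.
    have ab : flt G (beta b) (alpha a') by rewrite /flt abE.
    by have := za a'; rewrite (fle_trans (zb b) (flt_fle ab)).
Qed.

(** Both sides are at most 1: the parent of z and the color of the edge below z
    determine v and j, and z determines x. *)
Lemma sum_glue_graft :
  (\sum_v \sum_j (glue (alpha, beta) \in embs (graft T v S j) G setT) =
   \sum_(x | ~~ minimal G x) cut_embs x)%N.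
Proof.
under eq_bigr => v _ do under eq_bigr => j _ do rewrite glue_graft.
have cut_x x : ~~ minimal G x && (x != z) -> cut_embs x = 0%N :> nat.
  move=> /andP[_ xz]; case: (boolP (cut_embs x)) => // /cut_embs_root xE.
  by rewrite xE eqxx in xz.
have [zmin|zmin] := boolP (minimal G z).
  rewrite !big1 // => [x xmin|v _].
    by apply: cut_x; rewrite xmin; apply: contraNneq xmin => ->.
  by rewrite big1 // => j _; rewrite /edge minimalP ?andbF.
rewrite [RHS](bigD1 z) //= [X in (_ + X)%N]big1 // addn0.
have [zcut|_] := boolP (cut_embs z); last first.
  by rewrite big1 // => v _; rewrite big1 // => j _; rewrite !andbF.
have [w wz] := parent_exists zmin.
have : w \in alpha @: setT.
  case/andP: zcut => /embsP[_ -> _ _] _; rewrite !inE.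
  by apply/negP => zw; apply: fle_flt_false zw (edge_flt wz).
case/imsetP => v _ wE; rewrite {w}wE in wz.
have := edge_flt wz; rewrite /flt; case c: (ecol G (alpha v) z) => [j|] // _.
rewrite (bigD1 v) //= [X in (_ + X)%N]big1 => [|v' v'v]; last first.
  rewrite big1 // => j' _; rewrite andbT.
  case: (boolP (edge _ _ _)); rewrite ?andbF // => v'z; case/eqP: v'v.
  case/andP: zcut => /embsP[ai _ _ _] _; apply: ai.
  exact: edge_lower_unique v'z wz.
rewrite (bigD1 j) //= c eqxx wz big1 // => j' j'j.
by case: eqP => // -[jj']; rewrite jj' eqxx in j'j.
Qed.

End GraftCount.

(** Double counting of the isomorphisms from the graftings of S on T to G,
    according to the grafting vertex or to the image of the root of S. *)
Lemma card_embs_graft (L E Vt Vs V : finType) (T : lforest L E Vt)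
    (S : lforest L E Vs) (G : lforest L E V) : is_ltree S ->
  (\sum_v \sum_j #|embs (graft T v S j) G setT| =
   \sum_(x | ~~ minimal G x)
     #|embs T G (~: branch G x)| * #|embs S G (branch G x)|)%N.
Proof.
move=> /ltreeP[s0 s0_root].
transitivity (\sum_ab \sum_v \sum_j
    (glue ab \in embs (graft T v S j) G setT))%N.
  rewrite [RHS]exchange_big; apply: eq_bigr => v _.
  rewrite [RHS]exchange_big; apply: eq_bigr => j _.
  rewrite -sum1_card big_mkcond /= (reindex _ (onW_bij _ glue_bij)).
  by apply: eq_bigr => ab _; case: (_ \in _).
transitivity (\sum_ab \sum_(x | ~~ minimal G x) cut_embs T S G ab.1 ab.2 x)%N.
  by apply: eq_bigr => -[a b] _; apply: sum_glue_graft s0_root _ _.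
rewrite exchange_big; apply: eq_bigr => x _; rewrite -cardsX -sum1_card.
rewrite [RHS]big_mkcond; apply: eq_bigr => -[a b] _.
by rewrite /cut_embs in_setX /=; case: ifP.
Qed.

(** * Edge colors and vertex labels *)

Section SameOrder.

Context {L E L' E' : finType} {V : finType}.
Variables (F : lforest L E V) (G : lforest L' E' V).
Hypothesis same_flt : forall w v, flt G w v = flt F w v.

Lemma same_fle w v : fle G w v = fle F w v.
Proof. by rewrite /fle same_flt. Qed.

Lemma same_edge w v : edge G w v = edge F w v.
Proof.
rewrite /edge same_flt; congr (_ && ~~ _).
by apply: eq_existsb => x; rewrite !same_flt.
Qed.

Lemma same_minimal v : minimal G v = minimal F v.
Proof. by congr (~~ _); apply: eq_existsb => x; rewrite same_flt. Qed.

Lemma same_branch x : branch G x = branch F x.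
Proof. by apply/setP => v; rewrite !inE same_fle. Qed.

Lemma same_tree : is_ltree G = is_ltree F.
Proof.
by apply: eq_existsb => r; apply: eq_forallb => v; rewrite same_fle.
Qed.

End SameOrder.

Section EdgeColors.

Context {L : finType} {V : finType}.
Variable G : lforest L unit V.

(** The label of the child of w that is below v or equal to v. *)
Definition branch_label w v : option L :=
  omap (vlab G) [pick u | edge G w u && fle G u v].

Lemma branch_label_eq w u v :
  edge G w u -> fle G u v -> branch_label w v = Some (vlab G u).
Proof.
move=> wu uv; rewrite /branch_label; case: pickP => [u'|/(_ u)].
  by case/andP => wu' u'v; rewrite (edge_upper_unique wu wu' uv u'v).
by rewrite wu uv.
Qed.

Lemma isSome_branch_label w v : branch_label w v = flt G w v :> bool.
Proof.
rewrite /branch_label; case: pickP => [u /andP[wu uv]|no] /=.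
  by rewrite (flt_fle_trans (edge_flt wu) uv).
by apply/esym/negP => /flt_cover[u wu uv]; have := no u; rewrite wu uv.
Qed.

Fact branch_label_irr v : branch_label v v = None.
Proof.
have := isSome_branch_label v v.
by rewrite flt_irr; case: (branch_label v v).
Qed.

Fact branch_label_trans u v w : branch_label u v -> branch_label v w ->
  branch_label u w = branch_label u v.
Proof.
rewrite !isSome_branch_label => uv vw; have [x ux xv] := flt_cover uv.
rewrite (branch_label_eq ux xv) (branch_label_eq ux) //.
exact: fle_trans xv (flt_fle vw).
Qed.

Fact branch_label_chain x y z : y != z -> branch_label y x ->
  branch_label z x -> branch_label y z || branch_label z y.
Proof. rewrite !isSome_branch_label; exact: flt_chain. Qed.

Definition color_edges : lforest unit L V :=
  build (fun=> tt) branch_label_irr branch_label_trans branch_label_chain.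

Lemma ecol_color w v : ecol color_edges w v = branch_label w v.
Proof. exact: ecol_build. Qed.

Lemma flt_color w v : flt color_edges w v = flt G w v.
Proof. by rewrite /flt ecol_color isSome_branch_label. Qed.

(** In a convex set, which contains the path between any two of its vertices,
    the children on such a path are the same as in G. *)
Lemma color_sub (A : {set V}) :
  (forall u v w, flt G u v -> flt G v w -> u \in A -> w \in A -> v \in A) ->
  forall w v : {v | v \in A}, branch_label (val w) (val v) =
    omap (vlab G) (omap val [pick u : {v | v \in A} |
      edge (subforest G A) w u && fle (subforest G A) u v]).
Proof.
move=> convA [w wA] [v vA]; case: pickP => [[u uA]|no] /=.
  case/andP; rewrite fle_sub /edge flt_sub /= => /andP[wu /existsPn nou] uv.
  apply: branch_label_eq uv; rewrite /edge wu; apply/existsPn => x.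
  apply/negP => /andP[wx xu]; have xA := convA _ _ _ wx xu wA uA.
  by have := nou (exist _ x xA); rewrite !flt_sub wx xu.
have := isSome_branch_label w v; case wv: (flt G w v); last first.
  by case: (branch_label w v).
have [u wu uv] := flt_cover wv; have uA : u \in A.
  by case/orP: uv => [/eqP->//|uv]; apply: convA (edge_flt wu) uv wA vA.
have := no (exist _ u uA); rewrite fle_sub /edge flt_sub /= uv (edge_flt wu) /=.
rewrite andbT => /negbFE/existsP[[x xA]]; rewrite !flt_sub /= => /andP[wx xu].
by case: (edge_between wu wx xu).
Qed.

End EdgeColors.

Section ColorSubforest.

Context {L : finType}.

Lemma cls_color_sub (V : finType) (G : lforest L unit V) (A : {set V}) :
  (forall u v w, flt G u v -> flt G v w -> u \in A -> w \in A -> v \in A) ->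
  cls (color_edges (subforest G A)) = cls (subforest (color_edges G) A).
Proof.
move=> convA; apply: cls_id => [v|w v]; first by rewrite vlab_sub !vlab_build.
rewrite ecol_sub !ecol_color (color_sub convA) /branch_label.
by case: pickP => //= u _; rewrite vlab_sub.
Qed.

Lemma iso_map_color (V W : finType) (F : lforest L unit V)
    (G : lforest L unit W) h :
  iso_map F G h -> iso_map (color_edges F) (color_edges G) h.
Proof.
move=> hiso; have [hbij hl hc] := hiso; split=> // [v|w v].
  by rewrite !vlab_build.
rewrite !ecol_color; case wv: (flt F w v); last first.
  have := isSome_branch_label F w v; have := isSome_branch_label G (h w) (h v).
  by rewrite (flt_iso hiso) wv; do 2!case: (branch_label _ _ _).
have [u wu uv] := flt_cover wv.
rewrite (branch_label_eq wu uv) (@branch_label_eq _ _ _ (h w) (h u)) ?hl //.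
  by rewrite (edge_iso hiso).
by rewrite (fle_iso hiso).
Qed.

Lemma cls_color_iso (V W : finType) (F : lforest L unit V)
    (G : lforest L unit W) :
  iso F G -> cls (color_edges F) = cls (color_edges G).
Proof.
by move=> /isoP[h hiso]; apply/cls_eq/isoP; exists h; apply: iso_map_color.
Qed.

End ColorSubforest.

Section VertexLabels.

Context {n : nat}.

Section Labelled.

Variables (V : finType) (i : 'I_n).

(** The construction behind [label_vertices], on an arbitrary vertex set. *)
Definition upper_labels (F : lforest unit 'I_n V) : lforest 'I_n unit V :=
  relabel F
    (fun v => odflt i (obind (fun w => ecol F w v) [pick w | edge F w v]))
    (fun=> tt).

(** The construction behind [root_label], on an arbitrary vertex set. *)
Definition relabel_root (G : lforest 'I_n unit V) : lforest 'I_n unit V :=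
  relabel G (fun v => if minimal G v then i else vlab G v) id.

Lemma flt_upper F w v : flt (upper_labels F) w v = flt F w v.
Proof. by rewrite /flt ecol_build; case: (ecol _ _ _). Qed.

Lemma vlab_upper_min F v : minimal F v -> vlab (upper_labels F) v = i.
Proof.
move=> vmin; rewrite vlab_build; case: pickP => //= w /edge_flt.
by rewrite minimalP.
Qed.

Lemma vlab_upper_edge F w v : edge F w v ->
  ecol F w v = Some (vlab (upper_labels F) v).
Proof.
move=> wv; rewrite vlab_build; case: pickP => [w' w'v|/(_ w)].
  rewrite /= (edge_lower_unique wv w'v); have := edge_flt w'v; rewrite /flt.
  by case: (ecol _ _ _).
by rewrite wv.
Qed.

Lemma vlab_root_min G v : minimal G v -> vlab (relabel_root G) v = i.
Proof. by rewrite vlab_build => ->. Qed.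

Lemma flt_root G w v : flt (relabel_root G) w v = flt G w v.
Proof. by rewrite /flt ecol_build; case: (ecol _ _ _). Qed.

Lemma color_upper F : cls (color_edges (upper_labels F)) = cls F.
Proof.
apply: cls_id => [v|w v]; first by case: (vlab _ _); case: (vlab _ _).
rewrite ecol_color; case wv: (flt F w v); last first.
  have := isSome_branch_label (upper_labels F) w v.
  by rewrite flt_upper wv; move: wv; rewrite /flt;
    case: (ecol _ _ _); case: (branch_label _ _ _).
have [u wu uv] := flt_cover wv; rewrite (@branch_label_eq _ _ _ _ u).
- by rewrite (ecol_fle (edge_flt wu) uv) (vlab_upper_edge wu).
- by rewrite (same_edge (flt_upper F)).
- by rewrite (same_fle (flt_upper F)).
Qed.

Lemma vlab_upper_color G v : vlab (upper_labels (color_edges G)) v =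
  if minimal G v then i else vlab G v.
Proof.
have minE := same_minimal (flt_color G).
have [vmin|vmin] := boolP (minimal G v); first by rewrite vlab_upper_min ?minE.
have [w wv] := parent_exists vmin.
have := @vlab_upper_edge (color_edges G) w v.
rewrite (same_edge (flt_color G)) => /(_ wv).
by rewrite ecol_color (branch_label_eq wv (fle_refl _ _)) => -[].
Qed.

Lemma upper_color G : cls (upper_labels (color_edges G)) = cls (relabel_root G).
Proof.
apply: cls_id => [v|w v]; first by rewrite vlab_upper_color [RHS]vlab_build.
rewrite !ecol_build; have := isSome_branch_label G w v; rewrite /flt.
by case: (branch_label G w v); case: (ecol G w v) => // -[].
Qed.

End Labelled.

Lemma iso_map_upper (V W : finType) i (F : lforest unit 'I_n V)
    (G : lforest unit 'I_n W) h :
  iso_map F G h -> iso_map (upper_labels i F) (upper_labels i G) h.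
Proof.
move=> hiso; have [hbij hl hc] := hiso; split=> // [v|w v]; last first.
  by rewrite !ecol_build hc.
have [vmin|vmin] := boolP (minimal F v).
  by rewrite !vlab_upper_min // (minimal_iso hiso).
have [w wv] := parent_exists vmin; have := vlab_upper_edge i wv.
have := @vlab_upper_edge _ i G (h w) (h v); rewrite (edge_iso hiso) => /(_ wv).
by rewrite hc => -> [].
Qed.

Lemma cls_upper_iso (V W : finType) i (F : lforest unit 'I_n V)
    (G : lforest unit 'I_n W) :
  iso F G -> cls (upper_labels i F) = cls (upper_labels i G).
Proof.
by move=> /isoP[h hiso]; apply/cls_eq/isoP; exists h; apply: iso_map_upper.
Qed.

Lemma is_tree_color (T : vtree n) : is_ltree (color_edges (rep (val T))).
Proof. by rewrite (same_tree (flt_color _)); apply: (valP T). Qed.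

Definition color_tree (T : vtree n) : tree unit 'I_n := cls_tree (is_tree_color T).

Lemma label_color_tree i T : label_vertices i (color_tree T) = root_label i T.
Proof.
apply: val_inj; apply: etrans (upper_color i (rep (val T))).
exact/cls_upper_iso/rep_cls.
Qed.

Lemma color_label_tree i t : color_tree (label_vertices i t) = t.
Proof.
apply: val_inj; rewrite -[RHS]cls_rep -(color_upper i).
exact/cls_color_iso/rep_cls.
Qed.

Lemma root_label_inj (T : vtree n) : injective (fun i => root_label i T).
Proof.
move=> i j /(congr1 val)/cls_eq/isoP[h hiso].
have /ltreeP[r rP] := valP T; have rmin := root_minimal rP.
have [_ hl _] := hiso; rewrite -(vlab_root_min i rmin) -[LHS]hl.
apply: (vlab_root_min j).
have := minimal_iso hiso r.
by rewrite !(same_minimal (flt_root _ _)) rmin => ->.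
Qed.

Lemma root_label_own (T : vtree n) : exists i, root_label i T = T.
Proof.
have /ltreeP[r rP] := valP T; exists (vlab (rep (val T)) r).
apply: val_inj; rewrite -[RHS]cls_rep; apply: cls_id => [v|w v].
  rewrite vlab_build; case: ifP => // vmin.
  by rewrite (minimal_root rP vmin).
by rewrite ecol_build; case: (ecol _ _ _).
Qed.

(** Among the trees obtained from t by labeling its root, T appears once or not
    at all, since T remembers its root label. *)
Lemma sum_label_vertices (t : tree unit 'I_n) (T : vtree n) :
  (\sum_i (label_vertices i t == T) = (t == color_tree T))%N.
Proof.
have [->|tT] := eqVneq t (color_tree T); last first.
  rewrite big1 // => i _; case: eqP => // iT.
  by rewrite -iT color_label_tree eqxx in tT.
have [i0 Ti0] := root_label_own T.
rewrite (bigD1 i0) //= label_color_tree Ti0 eqxx big1 ?addn0 // => i ii0.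
rewrite label_color_tree; case: eqP => // iT; case/eqP: ii0.
by apply: (@root_label_inj T); rewrite iT.
Qed.

(** An automorphism of the edge-colored tree preserves the labels above the
    root, as they are the colors, and it fixes the root: no automorphism is
    gained by forgetting the root label. *)
Lemma card_aut_color (T : vtree n) :
  #|automorphisms (val (color_tree T))| = #|automorphisms (val T)|.
Proof.
rewrite !card_automorphisms (card_embs_iso (rep_cls _)).
set G := rep (val T); apply: eq_card => f.
have mapE (L E : finType) (F : lforest L E (vert (val T))) :
    f \in embs F F setT <-> iso_map F F f.
  split=> [/embsP[fi _ fl fc]|[fb fl fc]]; first by split=> //; apply: injF_bij.
  apply/embsP; split=> //; first exact: bij_inj.
  by apply/eqP; rewrite eqEcard subsetT (card_imset _ (bij_inj fb)) leqnn.
apply/idP/idP => /mapE fiso; apply/mapE; last exact: iso_map_color.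
have /ltreeP[r rP] := valP T; have [fb fl _] := iso_map_upper (vlab G r) fiso.
split=> // [v|w v]; last first.
  have := flt_iso fiso w v; rewrite !flt_color /flt.
  by case: (ecol G (f w) (f v)) => [[]|]; case: (ecol G w v) => [[]|].
have := fl v; rewrite !vlab_upper_color.
have := minimal_iso fiso v; rewrite !(same_minimal (flt_color G)) => fv.
case: ifP => fvmin; rewrite -fv fvmin // => _.
by rewrite (minimal_root rP fvmin) (minimal_root rP (etrans (esym fv) fvmin)).
Qed.

End VertexLabels.

(** * The inclusion into the free pre-Lie algebra *)

Section FreePreLieProduct.

Variables (k : fieldType) (n : nat).
Implicit Types (x y : freePL k n) (T t s : vtree n).

(** The value of x at the tree on A, multiplied by the number of automorphisms
    of this tree, and 0 if A is not a tree.  In this form the value is a sum of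
    numbers of isomorphisms, to which the double counting applies. *)
Definition embs_sum x (V : finType) (G : lforest 'I_n unit V) (A : {set V}) : k :=
  \sum_(t <- msupp x) x@_t * #|embs (rep (val t)) G A|%:R.

Lemma embs_sum_tree x (V : finType) (G : lforest 'I_n unit V) A T :
  val T = cls (subforest G A) ->
  embs_sum x G A = x@_T * #|automorphisms (val T)|%:R.
Proof.
move=> TA; rewrite -(msupp_sum_pick x T) mulr_suml; apply: eq_bigr => t _.
rewrite -mulrA card_embs cls_rep -TA -val_eqE card_automorphisms; congr (_ * _).
by case: eqP => [->|_]; rewrite ?mul1r ?mul0r.
Qed.

Lemma embs_sum_eq0 x (V : finType) (G : lforest 'I_n unit V) A :
  ~~ is_ltree (subforest G A) -> embs_sum x G A = 0.
Proof.
move=> notT; apply: big1 => t _; rewrite card_embs cls_rep.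
case: eqP => [tA|_]; last by rewrite mulr0.
by case/negP: notT; rewrite -is_tree_cls -tA; apply: (valP t).
Qed.

Lemma sum_graft_eq t s T :
  (\sum_(v : vert (val t)) (graft_vtree v s == T) * #|automorphisms (val T)| =
   \sum_(x | ~~ minimal (rep (val T)) x)
     #|embs (rep (val t)) (rep (val T)) (~: branch (rep (val T)) x)| *
     #|embs (rep (val s)) (rep (val T)) (branch (rep (val T)) x)|)%N.
Proof.
rewrite -card_embs_graft; last exact: (valP s).
apply: eq_bigr => v _; rewrite (bigD1 tt) //= big1 ?addn0 => [|[] //].
rewrite card_embs cls_subT cls_rep card_automorphisms -val_eqE /=.
case: eqP => [gT|_]; last by rewrite mul0n.
rewrite mul1n; apply: card_embs_iso; apply/cls_eq.
by rewrite cls_rep gT.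
Qed.

Lemma freePL_mul_coef x y T :
  (freePL_mul x y)@_T * #|automorphisms (val T)|%:R =
  \sum_(z | ~~ minimal (rep (val T)) z)
    embs_sum x (rep (val T)) (~: branch (rep (val T)) z) *
    embs_sum y (rep (val T)) (branch (rep (val T)) z).
Proof.
set G := rep (val T).
transitivity (\sum_(t <- msupp x) \sum_(s <- msupp y) \sum_(z | ~~ minimal G z)
    (x@_t * #|embs (rep (val t)) G (~: branch G z)|%:R) *
    (y@_s * #|embs (rep (val s)) G (branch G z)|%:R)).
  rewrite /freePL_mul (raddf_sum (mcoeff T)) mulr_suml; apply: eq_bigr => t _.
  rewrite (raddf_sum (mcoeff T)) mulr_suml; apply: eq_bigr => s _ /=.
  rewrite mcoeffZ (raddf_sum (mcoeff T)) /= -mulrA.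
  under [in LHS]eq_bigr => v _ do rewrite mcoeffU.
  rewrite -natr_sum -natrM big_distrl /= sum_graft_eq natr_sum mulr_sumr.
  by apply: eq_bigr => z _; rewrite natrM mulrACA.
under eq_bigr => t _ do rewrite exchange_big.
rewrite exchange_big; apply: eq_bigr => z _ /=.
rewrite /embs_sum mulr_suml; apply: eq_bigr => t _.
by rewrite mulr_sumr.
Qed.

End FreePreLieProduct.

Section LabelSum.

Variables (k : fieldType) (n : nat).
Implicit Types (f g : Cdual k n) (T : vtree n).

(** The image of the basis element dual to u. *)
Definition label_sum (u : eforest n) : freePL k n :=
  if insub u is Some t then
    (#|automorphisms u|%:R)^-1 *: \sum_i (<< label_vertices i t >> : freePL k n)
  else 0.

Lemma label_sum_coef u T :
  (label_sum u)@_T = (u == val (color_tree T))%:R / #|automorphisms (val T)|%:R.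
Proof.
rewrite /label_sum; case: insubP => [t _ tu|uT]; last first.
  rewrite mcoeff0; case: eqP => [uE|_]; last by rewrite mul0r.
  by case/negP: uT; rewrite uE; apply: valP.
rewrite mcoeffZ (raddf_sum (mcoeff T)) /=.
under eq_bigr => i _ do rewrite mcoeffU.
rewrite -natr_sum sum_label_vertices -tu mulrC.
have [->|tT] := eqVneq t (color_tree T); first by rewrite card_aut_color eqxx.
by rewrite (negbTE (contra_neq (@val_inj _ _ _ t (color_tree T)) tT)) !mul0r.
Qed.

Lemma label_sum_tree (t : tree unit 'I_n) : label_sum (val t) =
  (#|automorphisms (val t)|%:R)^-1 *:
    \sum_i (<< label_vertices i t >> : freePL k n).
Proof. by rewrite /label_sum valK. Qed.

End LabelSum.

(** Locked, because comparing two values of the inclusion by conversion would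
    unfold the whole construction. *)
HB.lock Definition to_freePL (k : fieldType) (n : nat) (f : Cdual k n) :
    freePL k n :=
  \sum_(u <- msupp f) f@_u *: label_sum k u.
Arguments to_freePL {k n} f.

Section Inclusion.

Variables (k : fieldType) (n : nat).
Implicit Types (f g : Cdual k n) (T : vtree n).

Lemma to_freePL_coef f T :
  (to_freePL f)@_T = f@_(val (color_tree T)) / #|automorphisms (val T)|%:R.
Proof.
rewrite to_freePL.unlock (raddf_sum (mcoeff T)) -(msupp_sum_pick f) mulr_suml.
by apply: eq_bigr => u _ /=; rewrite mcoeffZ label_sum_coef mulrA.
Qed.

Fact to_freePL_linear : linear (@to_freePL k n).
Proof.
move=> a f g; apply/malgP => T.
rewrite (to_freePL_coef (a *: f + g) T) 2!mcoeffD 2!mcoeffZ.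
by rewrite (to_freePL_coef f T) (to_freePL_coef g T) mulrDl mulrA.
Qed.

HB.instance Definition _ := GRing.isLinear.Build k (Cdual k n) (freePL k n)
  *:%R (@to_freePL k n) to_freePL_linear.

Lemma to_freePLU u : to_freePL (<< u >> : Cdual k n) = label_sum k u.
Proof.
by apply/malgP => T; rewrite to_freePL_coef label_sum_coef mcoeffU1.
Qed.

Hypothesis char0 : [pchar k] =i pred0.

Lemma automorphisms_neq0 (L E : finType) (u : forest L E) :
  #|automorphisms u|%:R != 0 :> k.
Proof.
by rewrite (pcharf0P k).1 // -lt0n card_automorphisms_gt0.
Qed.

(** Every edge-colored tree arises from some labeled tree, as soon as there is a
    label to put on its root. *)
Lemma to_freePL_inj f g : (0 < n)%N -> primitive f -> primitive g ->
  to_freePL f = to_freePL g -> f = g.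
Proof.
move=> n0 /primitiveP fT /primitiveP gT fg; apply/malgP => u.
have [uT|uT] := boolP (is_tree u); last by rewrite fT ?gT.
pose T := label_vertices (Ordinal n0) (exist _ u uT).
have : (to_freePL f)@_T = (to_freePL g)@_T by rewrite fg.
rewrite (to_freePL_coef f T) (to_freePL_coef g T) color_label_tree; apply/mulIf.
by rewrite invr_eq0 automorphisms_neq0.
Qed.

(** The factor 1/|Aut| in the inclusion cancels the automorphisms counted by
    [embs_sum], and only the values of f remain. *)
Lemma embs_sum_to_freePL f (V : finType) (G : lforest 'I_n unit V) (A : {set V}) :
  primitive f ->
  (forall u v w, flt G u v -> flt G v w -> u \in A -> w \in A -> v \in A) ->
  embs_sum (to_freePL f) G A = f@_(cls (subforest (color_edges G) A)).
Proof.
move=> /primitiveP fT convA; rewrite -cls_color_sub //.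
have [GA|GA] := boolP (is_ltree (subforest G A)); last first.
  rewrite embs_sum_eq0 // fT // is_tree_cls.
  by rewrite (same_tree (flt_color _)).
rewrite (@embs_sum_tree _ _ _ _ _ _ (cls_tree GA)) // to_freePL_coef.
rewrite divfK ?automorphisms_neq0 //.
by congr (f@_ _); apply/cls_color_iso/rep_cls.
Qed.

Lemma to_freePL_mul (q1 q2 : 'I_n -> k) f g :
  (forall j, q1 j = 1) -> (forall j, q2 j = 0) -> primitive f -> primitive g ->
  to_freePL (dual_mul q1 q2 g f) = freePL_mul (to_freePL f) (to_freePL g).
Proof.
move=> q1E q2E Pf Pg; apply/malgP => T.
apply: (mulIf (automorphisms_neq0 (val T))).
rewrite freePL_mul_coef to_freePL_coef divfK ?automorphisms_neq0 //.
set G := rep (val T); rewrite (@dual_mul_coef _ _ setT) // => [|j]; last first.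
  by rewrite inE q1E.
apply: eq_big => [z|z _].
  by rewrite cuttableT (same_minimal (flt_color G)).
rewrite (same_branch (flt_color G)); congr (_ * _); apply/esym.
  apply: embs_sum_to_freePL => // u v w _ vw; rewrite !inE => _; apply: contra => zv.
  exact: fle_trans zv (flt_fle vw).
apply: embs_sum_to_freePL => // u v w uv _; rewrite !inE => zu _.
exact: fle_trans zu (flt_fle uv).
Qed.

Lemma to_freePL_image (y : freePL k n) : (0 < n)%N ->
  (exists2 f, primitive f & to_freePL f = y) <->
  exists r : seq (k * vtree n),
    y = \sum_(a <- r) a.1 *: \sum_i (<< root_label i a.2 >> : freePL k n).
Proof.
move=> n0; split=> [[f /primitiveP fT <-]|[r ->]].
  rewrite to_freePL.unlock.
  apply: (big_ind (fun y : freePL k n => exists r : seq (k * vtree n),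
    y = \sum_(a <- r)
          a.1 *: \sum_i (<< root_label i a.2 >> : freePL k n))).
  - by exists [::]; rewrite big_nil.
  - by move=> _ _ [r ->] [s ->]; exists (r ++ s); rewrite big_cat.
  - move=> u _; have [uT|uT] := boolP (is_tree u); last first.
      by exists [::]; rewrite fT // scale0r big_nil.
    pose t : tree unit 'I_n := exist _ u uT.
    pose T := label_vertices (Ordinal n0) t.
    exists [:: (f@_u / #|automorphisms u|%:R, T)]; rewrite big_seq1 /=.
    have -> : label_sum k u = (#|automorphisms u|%:R)^-1 *:
        \sum_i (<< root_label i T >> : freePL k n).
      rewrite (label_sum_tree k t).
      by under [in RHS]eq_bigr => i _ do rewrite -label_color_tree color_label_tree.
    by rewrite scalerA.
pose P (y : freePL k n) := exists2 f, primitive f & to_freePL f = y.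
apply: (big_ind P).
- by exists 0; [apply/primitiveP => u _; rewrite mcoeff0 | rewrite linear0].
- move=> _ _ [f fP <-] [g gP <-]; exists (f + g); last by rewrite linearD.
  by rewrite -[f]scale1r; apply: primitive_linear.
- move=> [c T] _ /=.
  exists ((c * #|automorphisms (val (color_tree T))|%:R) *:
            (<< val (color_tree T) >> : Cdual k n)).
    apply/primitiveP => u uT; rewrite mcoeffZ mcoeffU1.
    by case: eqP => [tu|_]; rewrite ?mulr0 // -tu (valP (color_tree T)) in uT *.
  rewrite linearZ [X in _ *: X = _]to_freePLU label_sum_tree scalerA.
  rewrite mulfK; last exact: automorphisms_neq0.
  apply: (congr1 ( *:%R c)); apply: eq_bigr => i _.
  by rewrite label_color_tree.
Qed.

End Inclusion.

Theorem proposition7p2 (k : fieldType) (n : nat) (p : {set 'I_n})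
    (q1 q2 : 'I_n -> k)
    (q1E : forall j, q1 j = (if j \in p then 1 else 0))
    (q2E : forall j, q2 j = 0)
    (Delta : C k n -> C2 k n) (coproduct_Delta : is_coproduct q1 q2 Delta) :
  (* (i) *)
  pre_Lie_on (@primitive k n) (fun f g : Cdual k n => dual_mul q1 q2 g f) /\
  (* (ii) *)
  ((0 < n)%N -> [pchar k] =i pred0 -> p = [set: 'I_n] ->
   exists phi : {linear Cdual k n -> freePL k n},
     [/\ forall t : tree unit 'I_n,
           phi << val t >> =
           (#|automorphisms (val t)|%:R)^-1 *:
             \sum_(i in p) (<< label_vertices i t >> : freePL k n),
         forall f g, primitive f -> primitive g -> phi f = phi g -> f = g,
         forall f g, primitive f -> primitive g ->
           phi (dual_mul q1 q2 g f) = freePL_mul (phi f) (phi g)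
       & forall y : freePL k n,
           (exists2 f, primitive f & phi f = y) <->
           exists r : seq (k * vtree n),
             y = \sum_(a <- r)
                   a.1 *: \sum_(i in p) (<< root_label i a.2 >> : freePL k n)]).
Proof.
split; first exact: dual_mul_pre_Lie.
move=> n0 char0 pT; have sumT (h : 'I_n -> freePL k n) :
    \sum_(i in p) h i = \sum_i h i.
  by rewrite pT; apply: eq_bigl => i; rewrite inE.
exists (@to_freePL k n : {linear Cdual k n -> freePL k n}); split.
- by move=> t; rewrite sumT -label_sum_tree -to_freePLU.
- by move=> f g; apply: to_freePL_inj.
- by move=> f g; apply: to_freePL_mul => // j; rewrite q1E pT inE.
- move=> y; apply: iff_trans (to_freePL_image char0 y n0) _.
  by split=> -[r ->]; exists r; apply: eq_bigr => a _; rewrite sumT.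
Qed.
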